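(* Let $E$ be a directed graph, $K$ a field, $c=e_1\cdots e_n$ a simple closed path in $E$, and $K'\supseteq K$ any field extension. Let $\mathbf a=(a_e)\in(K'^* )^{E^1}$, $a=a_c=a_{e_1}\cdots a_{e_n}$, and let $V^{\mathbf a}_{[c^\infty],K'}$ be the $\mathbf a$-twisted Chen module over $L_{K'}(E)$. Denote by $V^{\mathbf a}_{[c^\infty],K'}|_K$ the $L_K(E)$-module obtained by restricting scalars from $L_{K'}(E)$ to $L_K(E)$. Then $$\mathrm{Ind}_{c^\infty}(K'^{(a)})=KL_{c^\infty}\otimes_{K(\mathcal G_E)_{c^\infty}}K'^{(a)}\cong V^{\mathbf a}_{[c^\infty],K'}|_K$$ as $L_K(E)$-modules.
   Context: $E=(E^0,E^1,s,r)$ is a directed graph of arbitrary cardinality. A vertex is singular if it emits no edges or infinitely many. Finite paths $\mu=e_1\cdots e_n$ ($r(e_i)=s(e_{i+1})$) have length $|\mu|=n$, source $s(e_1)$ and range $r(e_n)$; vertices are paths of length $0$; $F(E)$ is the set of finite paths, $E^\infty$ the set of infinite paths, $\partial E=E^\infty\cup\{\mu\in F(E): r(\mu)\text{ singular}\}$. For $x,y\in\partial E$, $x\sim_ky$ means $x=\mu p$, $y=\nu p$ with $\mu,\nu\in F(E)$, $p\in\partial E$, $r(\mu)=r(\nu)=s(p)$, $|\mu|-|\nu|=k$; $[x]=\{y: y\sim_kx\text{ for some }k\in\mathbb Z\}$. A closed path is a path of positive length with equal source and range; it is simple if it is not $d^m$ for a closed path $d$ and $m\ge2$; $c^\infty=ccc\cdots$.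 For a field $F$, $L_F(E)$ is the Leavitt path algebra: $F$-algebra generated by $\{v,e,e^*\mid v\in E^0,e\in E^1\}$ with relations $vw=\delta_{v,w}v$; $s(e)e=e=er(e)$; $r(e)e^*=e^*=e^*s(e)$; $e^*f=\delta_{e,f}r(e)$; $v=\sum_{s(e)=v}ee^*$ for non-singular $v$. It is spanned by $\mu\nu^*$ ($r(\mu)=r(\nu)$). The $L_F(E)$-module $V_{[x]}=V_{[x],F}$ is the $F$-space with basis $[x]$ and action $(\mu\nu^* ).p=\mu p'$ if $p=\nu p'$, $0$ otherwise. For $\mathbf a=(a_e)\in(F^* )^{E^1}$, $\sigma_{\mathbf a}$ is the automorphism of $L_F(E)$ with $v\mapsto v$, $e\mapsto a_ee$, $e^*\mapsto a_e^{-1}e^*$, and the twisted Chen module $V^{\mathbf a}_{[x],F}$ is the space $V_{[x],F}$ with action $(\eta,p)\mapsto\sigma_{\mathbf a}(\eta).p$. $\mathcal G_E=\{(x,k,y)\in\partial E\times\mathbb Z\times\partial E:x\sim_ky\}$ is the graph groupoid with $(x,k,y)(y,l,z)=(x,k+l,z)$, $(x,k,y)^{-1}=(y,-k,x)$, $d(x,k,y)=y$, $c(x,k,y)=x$ (units $(x,0,x)$ identified with $x$). The isotropy group at $x$ is $(\mathcal G_E)_x=\{(x,k,x)\in\mathcal G_E\}$; $(\mathcal G_E)_{c^\infty}=\{(c^\infty,kn,c^\infty):k\in\mathbb Z\}$ for $c$ simple closed of length $n$. $KL_x$ is the $K$-space with basis $L_x=\{(y,k,x)\in\mathcal G_E\}$,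 right $(\mathcal G_E)_x$-action by composition, left $L_K(E)$-action $\mu\nu^*(y,k,x)=(\mu p,|\mu|-|\nu|+k,x)$ if $y=\nu p$, $0$ otherwise. $\mathrm{Ind}_x(N)=KL_x\otimes_{K(\mathcal G_E)_x}N$. For $a\in K'^*$, $K'^{(a)}$ is the $K(\mathcal G_E)_{c^\infty}$-module with underlying space $K'$ and action $(c^\infty,kn,c^\infty)\lambda=a^k\lambda$. *)

(* Defs.v *)
From HB Require Import structures.
From mathcomp Require Import all_boot all_order all_algebra.
From mathcomp Require Import finmap monalg ring.
From mathcomp Require Import boolp classical_sets functions cardinality fsbigop.

Set Implicit Arguments.
Unset Strict Implicit.
Unset Printing Implicit Defensive.

Import GRing.Theory.
Local Open Scope ring_scope.
Local Open Scope classical_set_scope.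

(* {malg K[X]} is the K-vector space with basis X; << x >> is the basis vector
   attached to x : X, and lext f is the linear extension of f : X -> M.
   Some operations below are locked: conversion would otherwise unfold them. *)
Section LinearExtension.
Context {K : fieldType} {X : choiceType} {M : lmodType K}.

Fact lext_key : unit. Proof. exact: tt. Qed.
Definition lext (f : X -> M) : {malg K[X]} -> M :=
  locked_with lext_key (fun u => \sum_(x <- msupp u) u@_x *: f x).

Lemma lextEw f u (D : {fset X}) :
  (msupp u `<=` D)%fset -> lext f u = \sum_(x <- D) u@_x *: f x.
Proof.
rewrite /lext unlock => sD; apply: big_fset_incl => // x _.
by move=> /mcoeff_outdom ->; rewrite scale0r.
Qed.

Lemma lext_is_linear f : linear (lext f).
Proof.
move=> k u v; pose D := (msupp u `|` msupp v `|` msupp (k *: u + v))%fset.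
have sU : (msupp u `<=` D)%fset by rewrite /D -fsetUA fsubsetUl.
have sV : (msupp v `<=` D)%fset.
  by rewrite /D fsetUAC fsubsetUr.
have sW : (msupp (k *: u + v) `<=` D)%fset by rewrite /D fsubsetUr.
rewrite (lextEw _ sU) (lextEw _ sV) (lextEw _ sW) scaler_sumr -big_split /=.
by apply: eq_bigr => x _; rewrite mcoeffD mcoeffZ scalerDl scalerA.
Qed.
HB.instance Definition _ f :=
  GRing.isLinear.Build K {malg K[X]} M _ (lext f) (lext_is_linear f).

Lemma lextU f x : lext f << x >> = f x.
Proof.
rewrite (@lextEw _ _ [fset x]%fset) ?msuppU_le //.
by rewrite big_seq_fset1 mcoeffUU scale1r.
Qed.

Lemma malg_ind (P : {malg K[X]} -> Prop) :
  P 0 -> (forall k u v, P u -> P v -> P (k *: u + v)) ->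
  (forall x, P << x >>) -> forall u, P u.
Proof.
move=> P0 PD PU u; rewrite (monalgEw (fsubset_refl (msupp u))).
elim/big_ind: _ => // [x y Px Py|x _].
  by rewrite -[x]scale1r; apply: PD.
have -> : << u@_x *g x >> = u@_x *: << x >> + 0 :> {malg K[X]}.
  by apply/malgP => y; rewrite addr0 mcoeffZ !mcoeffU mulr_natr.
exact: PD.
Qed.

End LinearExtension.

Lemma lext_eq (K : fieldType) (X : choiceType) (M : lmodType K) (f g : X -> M) u :
  f =1 g -> lext f u = lext g u.
Proof.
by move=> fg; rewrite !(lextEw _ (fsubset_refl _)); apply: eq_bigr => x _; rewrite fg.
Qed.

Lemma lext_linearr (K : fieldType) (X Y : choiceType) (M : lmodType K)
    (f : X -> Y -> M) (u : {malg K[X]}) :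
  linear (fun v : {malg K[Y]} => lext (fun x => lext (f x) v) u).
Proof.
move=> k v w; elim/(@malg_ind K X): u => [|a u u' IHu IHu'|x].
- by rewrite !linear0 ?scaler0 addr0.
- have E (g : X -> M) : lext g (a *: u + u') = a *: lext g u + lext g u'.
    exact: linearP.
  by rewrite !E IHu IHu' !scalerDr !scalerA (mulrC k a) addrACA.
- by rewrite !lextU linearP.
Qed.

Inductive lspan (K : fieldType) (V : lmodType K) (R : set V) : V -> Prop :=
| lspan_gen u : R u -> lspan R u
| lspan0 : lspan R 0
| lspanP k u v : lspan R u -> lspan R v -> lspan R (k *: u + v).

Definition lspan_pred (K : fieldType) (V : lmodType K) (R : set V) : {pred V} :=
  [pred u | `[< lspan R u >]].

Section Quotient.
Context {K : fieldType} {V : lmodType K} (R : set V).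

Fact lspan_zmod_closed : zmod_closed (lspan_pred R).
Proof.
split=> [|u v /asboolP Ru /asboolP Rv]; apply/asboolP; first exact: lspan0.
by rewrite addrC -scaleN1r; apply: lspanP.
Qed.
HB.instance Definition _ := GRing.isZmodClosed.Build V (lspan_pred R)
  lspan_zmod_closed.

Definition lquot : Type := Quotient.quot (lspan_pred R).
HB.instance Definition _ := GRing.Zmodule.on lquot.

Definition lpi (u : V) : lquot := \pi_(Quotient.quot (lspan_pred R))%qT u.
Definition lrepr (x : lquot) : V := repr (x : Quotient.quot (lspan_pred R)).

Lemma lreprK : cancel lrepr lpi.
Proof. by move=> x; rewrite /lpi /lrepr reprK. Qed.

Lemma lpi_eq u v : (lpi u = lpi v) <-> lspan R (u - v).
Proof.
split=> [/eqP|h].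
  by rewrite -(Quotient.idealrBE (lspan_pred R)) => /asboolP.
by apply/eqP; rewrite -(Quotient.idealrBE (lspan_pred R)); apply/asboolP.
Qed.

Lemma lpi_gen u v : R (u - v) -> lpi u = lpi v.
Proof. by move=> h; apply/lpi_eq/lspan_gen. Qed.

Lemma lpiD u v : lpi (u + v) = lpi u + lpi v.
Proof. by rewrite /lpi raddfD. Qed.

Fact lquot_key : unit. Proof. exact: tt. Qed.
Definition lquot_scale : K -> lquot -> lquot :=
  locked_with lquot_key (fun k x => lpi (k *: lrepr x)).

Lemma lquot_scaleE k u : lquot_scale k (lpi u) = lpi (k *: u).
Proof.
rewrite /lquot_scale unlock; apply/lpi_eq.
rewrite -scalerBr -[_ *: _]addr0; apply: lspanP; last exact: lspan0.
by apply/lpi_eq; rewrite lreprK.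
Qed.

Fact lquot_scaleA a b x : lquot_scale a (lquot_scale b x) = lquot_scale (a * b) x.
Proof. by rewrite -[x]lreprK !lquot_scaleE scalerA. Qed.
Fact lquot_scale1 : left_id 1 lquot_scale.
Proof. by move=> x; rewrite -[x]lreprK !lquot_scaleE scale1r. Qed.
Fact lquot_scaleDr : right_distributive lquot_scale +%R.
Proof.
by move=> a x y; rewrite -[x]lreprK -[y]lreprK -lpiD !lquot_scaleE -lpiD scalerDr.
Qed.
Fact lquot_scaleDl x : {morph lquot_scale^~ x : a b / a + b}.
Proof. by move=> a b; rewrite -[x]lreprK !lquot_scaleE -lpiD scalerDl. Qed.
HB.instance Definition _ := GRing.Zmodule_isLmodule.Build K lquot
  lquot_scaleA lquot_scale1 lquot_scaleDr lquot_scaleDl.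

Fact lpi_is_linear : linear lpi.
Proof. by move=> k u v; rewrite lpiD -lquot_scaleE. Qed.
HB.instance Definition _ := GRing.isLinear.Build K V lquot _ lpi lpi_is_linear.

Lemma lquot_ind (P : lquot -> Prop) : (forall u, P (lpi u)) -> forall x, P x.
Proof. by move=> h x; rewrite -[x]lreprK. Qed.

Section Lift.
Context {W : lmodType K} (f : {linear V -> W}).
Hypothesis fR : forall u, R u -> f u = 0.

Lemma lspan_ker u : lspan R u -> f u = 0.
Proof.
elim=> [v /fR //||k v w _ fv _ fw]; first by rewrite raddf0.
by rewrite linearP fv fw scaler0 addr0.
Qed.

Definition lquot_lift (_ : forall u, R u -> f u = 0) : lquot -> W :=
  locked_with lquot_key (fun x => f (lrepr x)).

Lemma lquot_liftE u : lquot_lift fR (lpi u) = f u.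
Proof.
rewrite /lquot_lift unlock; apply/eqP; rewrite -subr_eq0 -raddfB; apply/eqP/lspan_ker.
by apply/lpi_eq; rewrite lreprK.
Qed.

Fact lquot_lift_is_linear : linear (lquot_lift fR).
Proof.
move=> k x y; elim/lquot_ind: x => x; elim/lquot_ind: y => y.
by rewrite -linearP !lquot_liftE linearP.
Qed.
HB.instance Definition _ :=
  GRing.isLinear.Build K lquot W _ (lquot_lift fR) lquot_lift_is_linear.
End Lift.
End Quotient.

(* Associative K-algebras without a unit in the signature: L_K(E) has no unit
   when E has infinitely many vertices. *)
HB.mixin Record Lmodule_isNualg (K : fieldType) A of GRing.Lmodule K A := {
  nmul : A -> A -> A;
  nmulA : associative nmul;
  nmulPl : forall b k a a', nmul (k *: a + a') b = k *: nmul a b + nmul a' b;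
  nmulPr : forall a k b b', nmul a (k *: b + b') = k *: nmul a b + nmul a b'
}.
#[short(type="nualgType")]
HB.structure Definition Nualg (K : fieldType) :=
  {A of GRing.Lmodule K A & Lmodule_isNualg K A}.

Notation "a ** b" := (nmul a b) (at level 40, left associativity) : ring_scope.

Section NualgTheory.
Context {K : fieldType} {A : nualgType K}.
Implicit Types a b : A.

Fact nmull_is_linear a : linear (nmul a).
Proof. by move=> k b b'; rewrite nmulPr. Qed.
HB.instance Definition _ a :=
  GRing.isLinear.Build K A A _ (nmul a) (nmull_is_linear a).

Lemma nmul0r a : 0 ** a = 0.
Proof. by have := nmulPl a (-1) 0 0; rewrite !scaleN1r addrC subrr addNr. Qed.
Lemma nmulr0 a : a ** 0 = 0. Proof. exact: linear0. Qed.
Lemma nmulDr a b b' : a ** (b + b') = a ** b + a ** b'. Proof. exact: linearD. Qed.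
Lemma nmulBr a b b' : a ** (b - b') = a ** b - a ** b'. Proof. exact: linearB. Qed.
Lemma nmulZr a k b : a ** (k *: b) = k *: (a ** b). Proof. exact: linearZ. Qed.
Lemma nmulDl a a' b : (a + a') ** b = a ** b + a' ** b.
Proof. by have := nmulPl b 1 a a'; rewrite !scale1r. Qed.
Lemma nmulZl k a b : (k *: a) ** b = k *: (a ** b).
Proof. by have := nmulPl b k a 0; rewrite nmul0r !addr0. Qed.
Lemma nmulBl a a' b : (a - a') ** b = a ** b - a' ** b.
Proof. by rewrite -scaleN1r nmulDl nmulZl scaleN1r. Qed.
End NualgTheory.

(* M with k : K acting as iota k; a field extension K'/K is given by its
   embedding iota. *)
Definition restr (K K' : fieldType) (iota : {rmorphism K -> K'}) (M : Type) : Type := M.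

Section Restriction.
Context {K K' : fieldType} (iota : {rmorphism K -> K'}).

Section Lmod.
Variable M : lmodType K'.
HB.instance Definition _ := GRing.Zmodule.copy (restr iota M) M.
Definition restr_scale (k : K) (m : restr iota M) : restr iota M :=
  iota k *: (m : M).
Fact restr_scaleA a b m : restr_scale a (restr_scale b m) = restr_scale (a * b) m.
Proof. by rewrite /restr_scale scalerA rmorphM. Qed.
Fact restr_scale1 : left_id 1 restr_scale.
Proof. by move=> m; rewrite /restr_scale rmorph1 scale1r. Qed.
Fact restr_scaleDr : right_distributive restr_scale +%R.
Proof. by move=> a m m'; rewrite /restr_scale scalerDr. Qed.
Fact restr_scaleDl m : {morph restr_scale^~ m : a b / a + b}.
Proof. by move=> a b; rewrite /restr_scale rmorphD scalerDl. Qed.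
HB.instance Definition _ := GRing.Zmodule_isLmodule.Build K (restr iota M)
  restr_scaleA restr_scale1 restr_scaleDr restr_scaleDl.

Lemma restrZ (k : K) (m : restr iota M) : k *: m = iota k *: (m : M).
Proof. by []. Qed.
End Lmod.

Section Alg.
Variable A : nualgType K'.
Definition restr_mul (a b : restr iota A) : restr iota A := (a : A) ** (b : A).
Fact restr_mulA : associative restr_mul.
Proof. exact: nmulA. Qed.
Fact restr_mulPl b k a a' :
  restr_mul (k *: a + a') b = k *: restr_mul a b + restr_mul a' b.
Proof. exact: nmulPl. Qed.
Fact restr_mulPr a k b b' :
  restr_mul a (k *: b + b') = k *: restr_mul a b + restr_mul a b'.
Proof. exact: nmulPr. Qed.
HB.instance Definition _ := Lmodule_isNualg.Build K (restr iota A)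
  restr_mulA restr_mulPl restr_mulPr.
End Alg.
End Restriction.

Definition salg (K : fieldType) (S : semigroupType) : Type := {malg K[S]}.

Section SemigroupAlgebra.
Context {K : fieldType} {S : semigroupType}.
HB.instance Definition _ := GRing.Lmodule.copy (salg K S) {malg K[S]}.

Definition sbasis (x : S) : salg K S := << x >>.

Lemma salg_ind (P : salg K S -> Prop) :
  P 0 -> (forall k u v, P u -> P v -> P (k *: u + v)) ->
  (forall x, P (sbasis x)) -> forall u, P u.
Proof. exact: malg_ind. Qed.

Definition slext (M : lmodType K) (f : S -> M) (u : salg K S) : M := lext f u.
HB.instance Definition _ (M : lmodType K) (f : S -> M) :=
  GRing.isLinear.Build K (salg K S) M _ (@slext M f) (@lext_is_linear K S M f).

Lemma slextU (M : lmodType K) (f : S -> M) x : slext f (sbasis x) = f x.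
Proof. exact: lextU. Qed.
Lemma slextP (M : lmodType K) (f : S -> M) k u v :
  slext f (k *: u + v) = k *: slext f u + slext f v.
Proof. exact: linearP. Qed.

Fact salg_mul_key : unit. Proof. exact: tt. Qed.
Definition salg_mul : salg K S -> salg K S -> salg K S :=
  locked_with salg_mul_key
    (fun u v => slext (fun x => slext (fun y => sbasis (x * y)%g) v) u).

Fact salg_mulPl v k u u' :
  salg_mul (k *: u + u') v = k *: salg_mul u v + salg_mul u' v.
Proof. by rewrite /salg_mul unlock; exact: slextP. Qed.

Fact salg_mulPr u k v v' :
  salg_mul u (k *: v + v') = k *: salg_mul u v + salg_mul u v'.
Proof.
rewrite /salg_mul unlock; exact: (lext_linearr (fun x y => sbasis (x * y)%g)).
Qed.

Lemma salg_mulU x y : salg_mul (sbasis x) (sbasis y) = sbasis (x * y)%g.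
Proof. by rewrite /salg_mul unlock !slextU. Qed.

Fact salg_mulA : associative salg_mul.
Proof.
have sm0 z : salg_mul z 0 = 0.
  by have := salg_mulPr z (-1) 0 0; rewrite !scaleN1r addrC subrr addNr.
have s0m z : salg_mul 0 z = 0 by rewrite /salg_mul unlock linear0.
move=> u v w; elim/(@salg_ind): u => [|a u u' IHu IHu'|x].
- by rewrite !s0m.
- by rewrite !salg_mulPl IHu IHu'.
elim/(@salg_ind): v => [|a v v' IHv IHv'|y].
- by rewrite s0m sm0 s0m.
- rewrite (salg_mulPl w a v v') (salg_mulPr _ a v v').
  by rewrite (salg_mulPr _ a (salg_mul v w)) IHv IHv' (salg_mulPl w a).
elim/(@salg_ind): w => [|a w w' IHw IHw'|z].
- by rewrite !sm0.
- rewrite (salg_mulPr (sbasis y) a w w').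
  rewrite (salg_mulPr _ a (salg_mul (sbasis y) w) (salg_mul (sbasis y) w')).
  by rewrite IHw IHw' (salg_mulPr _ a w w').
by rewrite !salg_mulU mulgA.
Qed.

HB.instance Definition _ := Lmodule_isNualg.Build K (salg K S)
  salg_mulA salg_mulPl salg_mulPr.

Lemma sbasisM (x y : S) : sbasis x ** sbasis y = sbasis (x * y)%g.
Proof. exact: salg_mulU. Qed.
End SemigroupAlgebra.

Record lend (K : fieldType) (M : lmodType K) := Lend {
  lend_fun :> M -> M;
  lend_linear : linear lend_fun
}.

Section Endomorphisms.
Context {K : fieldType} {M : lmodType K}.

HB.instance Definition _ := gen_eqMixin (lend M).
HB.instance Definition _ := gen_choiceMixin (lend M).
HB.instance Definition _ (f : lend M) :=
  GRing.isLinear.Build K M M _ (lend_fun f) (lend_linear f).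

Lemma lendP (f g : lend M) : f =1 g -> f = g.
Proof.
case: f g => f lf [g lg] /= /funext fg; rewrite fg in lf *.
by rewrite (Prop_irrelevance lf lg).
Qed.

Fact lend0_linear : linear (fun _ : M => 0 : M).
Proof. by move=> k x y; rewrite scaler0 addr0. Qed.
Fact lendN_linear (f : lend M) : linear (fun x => - f x).
Proof. by move=> k x y; rewrite linearP opprD scalerN. Qed.
Fact lendD_linear (f g : lend M) : linear (fun x => f x + g x).
Proof. by move=> k x y; rewrite !linearP scalerDr addrACA. Qed.
Fact lendZ_linear k (f : lend M) : linear (fun x => k *: f x).
Proof. by move=> l x y; rewrite linearP scalerDr !scalerA (mulrC l k). Qed.
Fact lendM_linear (f g : lend M) : linear (fun x => f (g x)).
Proof. by move=> k x y; rewrite !linearP. Qed.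

Definition lend_opp f := Lend (lendN_linear f).
Definition lend_add f g := Lend (lendD_linear f g).
Definition lend_scale k f := Lend (lendZ_linear k f).
Definition lend_mul f g := Lend (lendM_linear f g).

Fact lend_addA : associative lend_add.
Proof. by move=> f g h; apply: lendP => x; apply: addrA. Qed.
Fact lend_addC : commutative lend_add.
Proof. by move=> f g; apply: lendP => x; apply: addrC. Qed.
Fact lend_add0 : left_id (Lend lend0_linear) lend_add.
Proof. by move=> f; apply: lendP => x; apply: add0r. Qed.
Fact lend_addN : left_inverse (Lend lend0_linear) lend_opp lend_add.
Proof. by move=> f; apply: lendP => x; apply: addNr. Qed.
HB.instance Definition _ := GRing.isZmodule.Build (lend M)
  lend_addA lend_addC lend_add0 lend_addN.

Fact lend_scaleA a b f : lend_scale a (lend_scale b f) = lend_scale (a * b) f.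
Proof. by apply: lendP => x; apply: scalerA. Qed.
Fact lend_scale1 : left_id 1 lend_scale.
Proof. by move=> f; apply: lendP => x; apply: scale1r. Qed.
Fact lend_scaleDr : right_distributive lend_scale +%R.
Proof. by move=> k f g; apply: lendP => x; apply: scalerDr. Qed.
Fact lend_scaleDl f : {morph lend_scale^~ f : a b / a + b}.
Proof. by move=> a b; apply: lendP => x; apply: scalerDl. Qed.
HB.instance Definition _ := GRing.Zmodule_isLmodule.Build K (lend M)
  lend_scaleA lend_scale1 lend_scaleDr lend_scaleDl.

Fact lend_mulA : associative lend_mul.
Proof. by move=> f g h; apply: lendP. Qed.
Fact lend_mulPl h k f g :
  lend_mul (k *: f + g) h = k *: lend_mul f h + lend_mul g h.
Proof. by apply: lendP. Qed.
Fact lend_mulPr h k f g :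
  lend_mul h (k *: f + g) = k *: lend_mul h f + lend_mul h g.
Proof. by apply: lendP => x; rewrite /= linearP. Qed.
HB.instance Definition _ := Lmodule_isNualg.Build K (lend M)
  lend_mulA lend_mulPl lend_mulPr.

Lemma lend0E x : (0 : lend M) x = 0. Proof. by []. Qed.
Lemma lendDE (f g : lend M) x : (f + g) x = f x + g x. Proof. by []. Qed.
Lemma lendBE (f g : lend M) x : (f - g) x = f x - g x. Proof. by []. Qed.
Lemma lendZE k (f : lend M) x : (k *: f) x = k *: f x. Proof. by []. Qed.
Lemma lendME (f g : lend M) x : (f ** g) x = f (g x). Proof. by []. Qed.
End Endomorphisms.

(* Without a unit, the two-sided ideal generated by R is the span of the
   elements r, ar, ra and arb with r in R. *)
Definition ideal_gens (K : fieldType) (A : nualgType K) (R : set A) : set A :=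
  [set x | exists2 r, R r & [\/ x = r, exists a, x = a ** r, exists a, x = r ** a |
                              exists a b, x = a ** r ** b]].

Definition aquot (K : fieldType) (A : nualgType K) (R : set A) : Type :=
  lquot (ideal_gens R).

Section IdealQuotient.
Context {K : fieldType} {A : nualgType K} (R : set A).
HB.instance Definition _ := GRing.Lmodule.on (aquot R).

Let I := lspan (ideal_gens R).

Lemma idealMl a u : I u -> I (a ** u).
Proof.
elim=> [v [r Rr Hv]||k v w _ Iv _ Iw].
- apply: lspan_gen; exists r => //; case: Hv => [->|[b ->]|[b ->]|[b [c ->]]].
  + by apply: Or42; exists a.
  + by apply: Or42; exists (a ** b); rewrite nmulA.
  + by apply: Or44; exists a, b; rewrite nmulA.
  + by apply: Or44; exists (a ** b), c; rewrite !nmulA.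
- by rewrite nmulr0; apply: lspan0.
- by rewrite nmulPr; apply: lspanP.
Qed.

Lemma idealMr a u : I u -> I (u ** a).
Proof.
elim=> [v [r Rr Hv]||k v w _ Iv _ Iw].
- apply: lspan_gen; exists r => //; case: Hv => [->|[b ->]|[b ->]|[b [c ->]]].
  + by apply: Or43; exists a.
  + by apply: Or44; exists b, a.
  + by apply: Or43; exists (b ** a); rewrite nmulA.
  + by apply: Or44; exists b, (c ** a); rewrite !nmulA.
- by rewrite nmul0r; apply: lspan0.
- by rewrite nmulPl; apply: lspanP.
Qed.

Definition api : A -> aquot R := @lpi K A (ideal_gens R).
HB.instance Definition _ := GRing.Linear.copy api (@lpi K A (ideal_gens R)).

Let aK (x : aquot R) : api (lrepr x) = x. Proof. exact: lreprK. Qed.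

Definition aquot_mul : aquot R -> aquot R -> aquot R :=
  locked_with lquot_key (fun x y => api (lrepr x ** lrepr y)).

Lemma aquot_mulE a b : aquot_mul (api a) (api b) = api (a ** b).
Proof.
have rp c : I (lrepr (api c) - c) by apply/lpi_eq; rewrite lreprK.
rewrite /aquot_mul unlock; apply/lpi_eq; rewrite -[X in X - _](subrK (lrepr (api a) ** b)) -nmulBr -addrA -nmulBl.
rewrite -[X in X + _]scale1r; apply: lspanP.
  exact/idealMl/rp.
exact/idealMr/rp.
Qed.

Fact aquot_mulA : associative aquot_mul.
Proof.
move=> a b c; rewrite -[a]aK -[b]aK -[c]aK.
by rewrite !aquot_mulE nmulA.
Qed.
Fact aquot_mulPl z k x y :
  aquot_mul (k *: x + y) z = k *: aquot_mul x z + aquot_mul y z.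
Proof.
rewrite -[x]aK -[y]aK -[z]aK.
by rewrite -linearP !aquot_mulE nmulPl linearP.
Qed.
Fact aquot_mulPr z k x y :
  aquot_mul z (k *: x + y) = k *: aquot_mul z x + aquot_mul z y.
Proof.
rewrite -[x]aK -[y]aK -[z]aK.
by rewrite -linearP !aquot_mulE nmulPr linearP.
Qed.
HB.instance Definition _ := Lmodule_isNualg.Build K (aquot R)
  aquot_mulA aquot_mulPl aquot_mulPr.

Lemma apiM a b : api (a ** b) = api a ** api b.
Proof. by rewrite -aquot_mulE. Qed.
Lemma aquot_ind (P : aquot R -> Prop) : (forall u, P (api u)) -> forall x, P x.
Proof. exact: lquot_ind. Qed.
Lemma api_gen u v : R (u - v) -> api u = api v.
Proof. by move=> h; apply: lpi_gen; exists (u - v) => //; apply: Or41. Qed.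
End IdealQuotient.

(* Only nonempty words, so that the free algebra below is the nonunital one. *)
Definition nword (X : choiceType) : Type := (X * seq X)%type.
HB.instance Definition _ (X : choiceType) := Choice.on (nword X).
Definition nword_cat (X : choiceType) (w w' : nword X) : nword X :=
  (w.1, w.2 ++ w'.1 :: w'.2).
Fact nword_catA (X : choiceType) : associative (@nword_cat X).
Proof. by move=> u v w; rewrite /nword_cat /= -catA. Qed.
HB.instance Definition _ (X : choiceType) := isSemigroup.Build (nword X) (@nword_catA X).

Notation free_nualg K X := (salg K (nword X)).
Definition free_gen (K : fieldType) (X : choiceType) (x : X) : free_nualg K X :=
  sbasis ((x, [::]) : nword X).

Section Presentation.
Context {K : fieldType} {X : choiceType} (R : set (free_nualg K X)).

Definition pres_gen (x : X) : aquot R := api R (free_gen K x).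

Section Lift.
Context {B : nualgType K} (f : X -> B).

Definition weval (w : nword X) : B := foldl (fun b y => b ** f y) (f w.1) w.2.
Definition feval : free_nualg K X -> B := slext weval.
HB.instance Definition _ := GRing.Linear.copy feval (slext weval).

Lemma wevalM (v w : nword X) : weval (v * w)%g = weval v ** weval w.
Proof.
rewrite /weval /=; case: v w => x s [y t] /=; rewrite foldl_cat /=.
elim/last_ind: t => [//|t z IH]; rewrite -!cats1 !foldl_cat /= IH.
by rewrite nmulA.
Qed.

Lemma fevalU w : feval (sbasis w) = weval w. Proof. exact: slextU. Qed.
Lemma feval_gen x : feval (free_gen K x) = f x.
Proof. exact: fevalU. Qed.

Lemma fevalM u v : feval (u ** v) = feval u ** feval v.
Proof.
have fP k a b : feval (k *: a + b) = k *: feval a + feval b by exact: slextP.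
elim/(@salg_ind K (nword X)): u => [|a u u' IHu IHu'|x].
- by rewrite nmul0r linear0 nmul0r.
- by rewrite nmulPl (fP a u u') (fP a (u ** v)) nmulPl IHu IHu'.
elim/(@salg_ind K (nword X)): v => [|a v v' IHv IHv'|y].
- by rewrite nmulr0 linear0 nmulr0.
- by rewrite nmulPr (fP a v v') (fP a (_ ** v)) nmulPr IHv IHv'.
by rewrite sbasisM !fevalU wevalM.
Qed.

Hypothesis fR : forall r, R r -> feval r = 0.

Lemma feval_ideal u : ideal_gens R u -> feval u = 0.
Proof.
case=> r /fR r0 [->//|[a ->]|[a ->]|[a [b ->]]];
  by rewrite !fevalM r0 ?(nmulr0, nmul0r).
Qed.

Definition pres_lift : aquot R -> B :=
  lquot_lift feval_ideal.
HB.instance Definition _ := GRing.Linear.copy pres_lift (lquot_lift feval_ideal).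

Lemma pres_liftE u : pres_lift (api R u) = feval u.
Proof. exact: lquot_liftE. Qed.
Lemma pres_liftM x y : pres_lift (x ** y) = pres_lift x ** pres_lift y.
Proof.
elim/(@aquot_ind K (free_nualg K X) R): x => x.
elim/(@aquot_ind K (free_nualg K X) R): y => y.
by rewrite -apiM !pres_liftE fevalM.
Qed.
Lemma pres_lift_gen x : pres_lift (pres_gen x) = f x.
Proof. by rewrite pres_liftE feval_gen. Qed.
End Lift.

Lemma pres_ind (P : aquot R -> Prop) :
  P 0 -> (forall k u v, P u -> P v -> P (k *: u + v)) ->
  (forall u v, P u -> P v -> P (u ** v)) ->
  (forall x, P (pres_gen x)) -> forall u, P u.
Proof.
move=> P0 PP PM PX; elim/(@aquot_ind K (free_nualg K X) R)=> u.
elim/(@salg_ind K (nword X)): u => [|a u u' IHu IHu'|[x s]].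
- by rewrite linear0.
- by rewrite linearP; apply: PP.
elim/last_ind: s x => [|s y IH] x; first exact: PX.
have -> : sbasis ((x, rcons s y) : nword X) =
          (sbasis ((x, s) : nword X) : free_nualg K X) ** free_gen K y.
  by rewrite /free_gen sbasisM /nword_cat -cats1.
by rewrite apiM; apply: PM; [exact: IH | exact: PX].
Qed.
End Presentation.

(* Modules over a (nonunital) K-algebra are K-vector spaces with a K-bilinear
   associative action. *)
Record leftModule (K : fieldType) (A : nualgType K) := LeftModule {
  lm_car :> lmodType K;
  lact : A -> lm_car -> lm_car;
  lact_linearl : forall m, linear (fun a => lact a m);
  lact_linearr : forall a, linear (lact a);
  lactM : forall a b m, lact (a ** b) m = lact a (lact b m)
}.

Record rightModule (K : fieldType) (B : nualgType K) := RightModule {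
  rm_car :> lmodType K;
  ract : rm_car -> B -> rm_car;
  ract_linearl : forall b, linear (fun m => ract m b);
  ract_linearr : forall m, linear (ract m);
  ractM : forall m a b, ract m (a ** b) = ract (ract m a) b
}.

Record bimodule (K : fieldType) (A B : nualgType K) := Bimodule {
  bm_left : leftModule A;
  bm_act : bm_left -> B -> bm_left;
  bm_linearl : forall b, linear (fun m => bm_act m b);
  bm_linearr : forall m, linear (bm_act m);
  bm_actM : forall m a b, bm_act m (a ** b) = bm_act (bm_act m a) b;
  bm_actC : forall a m b, bm_act (lact a m) b = lact a (bm_act m b)
}.

Definition bm_right (K : fieldType) (A B : nualgType K) (M : bimodule A B) : rightModule B :=
  RightModule (@bm_linearl K A B M) (@bm_linearr K A B M) (@bm_actM K A B M).

Definition module_iso (K : fieldType) (A : nualgType K) (M N : leftModule A) : Prop :=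
  exists2 f : {linear M -> N}, bijective f &
    forall (a : A) (m : M), f (lact a m) = lact a (f m).

Section Tensor.
Context {K : fieldType} {A B : nualgType K}.

Definition tensor_relators (M : rightModule B) (N : leftModule B) :
    set {malg K[(M * N)%type]} :=
  [set u |
    [\/ exists m m' n, u = << (m + m', n) >> - (<< (m, n) >> + << (m', n) >>),
        exists m n n', u = << (m, n + n') >> - (<< (m, n) >> + << (m, n') >>),
        exists k m n, u = << (k *: m, n) >> - k *: << (m, n) >>
      | exists k m n, u = << (m, k *: n) >> - k *: << (m, n) >> ] \/
    exists m b n, u = << (ract m b, n) >> - << (m, lact b n) >>].

Definition tensor (M : rightModule B) (N : leftModule B) : lmodType K :=
  lquot (@tensor_relators M N).
Definition tens (M : rightModule B) (N : leftModule B) (m : M) (n : N) : tensor M N :=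
  lpi (@tensor_relators M N) << (m, n) >>.

Section Lact.
Variables (M : bimodule A B) (N : leftModule B) (a : A).
Let R := @tensor_relators (bm_right M) N.

Definition tensor_lact_pre : {malg K[(bm_right M * N)%type]} -> lquot R :=
  lext (fun mn => lpi R << (lact a (mn.1 : bm_left M) : bm_right M, mn.2) >>).
HB.instance Definition _ := GRing.Linear.copy tensor_lact_pre
  (lext (fun mn => lpi R << (lact a (mn.1 : bm_left M) : bm_right M, mn.2) >>)).

Fact tensor_lact_subproof u : R u -> tensor_lact_pre u = 0.
Proof.
have pE (m : bm_right M) n : tensor_lact_pre << (m, n) >> =
     lpi R << (lact a (m : bm_left M) : bm_right M, n) >> by exact: lextU.
have lD (m m' : bm_left M) : lact a (m + m') = lact a m + lact a m'.
  by rewrite -[m]scale1r lact_linearr !scale1r.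
have l0 : lact a (0 : bm_left M) = 0.
  by apply: (addrI (lact a (0 : bm_left M))); rewrite -lD !addr0.
have lZ k (m : bm_left M) : lact a (k *: m) = k *: lact a m.
  by rewrite -[_ *: _]addr0 lact_linearr l0 addr0.
have pB w v : tensor_lact_pre (w - v) = tensor_lact_pre w - tensor_lact_pre v.
  exact: linearB.
have pD w v : tensor_lact_pre (w + v) = tensor_lact_pre w + tensor_lact_pre v.
  exact: linearD.
have pZ k w : tensor_lact_pre (k *: w) = k *: tensor_lact_pre w by exact: linearZ.
have qZ k w : lpi R (k *: w) = k *: lpi R w by exact: linearZ.
have subr0_eq2 (x y : lquot R) : x = y -> x - y = 0 by move=> ->; rewrite subrr.
case=> [[[m [m' [n ->]]]|[m [n [n' ->]]]|[k [m [n ->]]]|[k [m [n ->]]]]|[m [b [n ->]]]];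
  rewrite pB; apply: subr0_eq2.
- rewrite pD !pE -lpiD; apply: lpi_gen; left; apply: Or41; rewrite lD.
  by exists (lact a (m : bm_left M) : bm_right M), (lact a (m' : bm_left M) : bm_right M), n.
- rewrite pD !pE -lpiD; apply: lpi_gen; left; apply: Or42.
  by exists (lact a (m : bm_left M) : bm_right M), n, n'.
- rewrite pZ !pE -qZ; apply: lpi_gen; left; apply: Or43; rewrite lZ.
  by exists k, (lact a (m : bm_left M) : bm_right M), n.
- rewrite pZ !pE -qZ; apply: lpi_gen; left; apply: Or44.
  by exists k, (lact a (m : bm_left M) : bm_right M), n.
- rewrite !pE; apply: lpi_gen; right; exists (lact a (m : bm_left M) : bm_right M), b, n.
  by rewrite /= bm_actC.
Qed.

Definition tensor_lact : tensor (bm_right M) N -> tensor (bm_right M) N :=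
  lquot_lift tensor_lact_subproof.
HB.instance Definition _ := GRing.Linear.copy tensor_lact (lquot_lift tensor_lact_subproof).

Lemma tensor_lactE m n :
  tensor_lact (tens m n) = tens (lact a (m : bm_left M) : bm_right M) n.
Proof. by rewrite /tensor_lact lquot_liftE; apply: lextU. Qed.
End Lact.

Lemma tensor_ind (M : rightModule B) (N : leftModule B) (P : tensor M N -> Prop) :
  P 0 -> (forall k u v, P u -> P v -> P (k *: u + v)) ->
  (forall m n, P (tens m n)) -> forall u, P u.
Proof.
move=> P0 PP PT; elim/(@lquot_ind K {malg K[(M * N)%type]} (@tensor_relators M N))=> u.
elim/(@malg_ind K (M * N)%type): u => [|k u v Pu Pv|[m n]].
- by rewrite linear0.
- by rewrite linearP; apply: PP.
- exact: PT.
Qed.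

Lemma tensPl (M : rightModule B) (N : leftModule B) k (m m' : M) (n : N) :
  tens (k *: m + m') n = k *: tens m n + tens m' n.
Proof.
rewrite /tens -linearP /=; transitivity (lpi (@tensor_relators M N) (<<(k *: m, n)>> + <<(m', n)>>)).
  by apply: lpi_gen; left; apply: Or41; exists (k *: m), m', n.
rewrite !lpiD; congr (_ + _).
by apply: lpi_gen; left; apply: Or43; exists k, m, n.
Qed.

Section LeftTensor.
Variables (M : bimodule A B) (N : leftModule B).

Fact tensor_lact_linearl (u : tensor (bm_right M) N) : linear (fun a => @tensor_lact M N a u).
Proof.
have tP c l x y : @tensor_lact M N c (l *: x + y) = l *: tensor_lact c x + tensor_lact c y.
  exact: linearP.
move=> k a b; elim/(@tensor_ind (bm_right M) N): u => [|l u v IHu IHv|m n].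
- by rewrite !linear0 ?scaler0 addr0.
- by rewrite !tP IHu IHv !scalerDr !scalerA (mulrC l k) addrACA.
- rewrite !tensor_lactE -tensPl; congr (tens _ _).
  exact: (@lact_linearl _ _ (bm_left M)).
Qed.

Fact tensor_lactM a b (u : tensor (bm_right M) N) :
  @tensor_lact M N (a ** b) u = tensor_lact a (tensor_lact b u).
Proof.
have tP c l x y : @tensor_lact M N c (l *: x + y) = l *: tensor_lact c x + tensor_lact c y.
  exact: linearP.
elim/(@tensor_ind (bm_right M) N): u => [|l u v IHu IHv|m n].
- by rewrite !linear0.
- by rewrite !tP IHu IHv.
- by rewrite !tensor_lactE lactM.
Qed.

Definition tensor_left : leftModule A := LeftModule tensor_lact_linearl
  (fun a => linearP (@tensor_lact M N a)) tensor_lactM.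
End LeftTensor.
End Tensor.

(* Classically every type carries a choiceType structure, so vertices and edges
   are arbitrary sets. *)
Record digraph := Digraph {
  vertex : choiceType;
  edge : choiceType;
  src : edge -> vertex;
  rng : edge -> vertex
}.

Section Graph.
Context {E : digraph}.

Definition out_edges (v : vertex E) : set (edge E) := [set e | src e = v].

Definition singular (v : vertex E) : Prop :=
  out_edges v = set0 \/ infinite_set (out_edges v).

Fixpoint is_path (v : vertex E) (l : seq (edge E)) : bool :=
  if l is e :: l' then (src e == v) && is_path (rng e) l' else true.
End Graph.

(* The vertex v is the path with source v and no edges. *)
Record fpath (E : digraph) := FPath {
  fp_src : vertex E;
  fp_edges : seq (edge E);
  fp_path : is_path fp_src fp_edges
}.

Record ipath (E : digraph) := IPath {
  ip_edge :> nat -> edge E;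
  ip_path : forall i, rng (ip_edge i) = src (ip_edge i.+1)
}.

Section Paths.
Context {E : digraph}.

Definition fp_rng (mu : fpath E) : vertex E := last (fp_src mu) (map (@rng E) (fp_edges mu)).
Definition fp_len (mu : fpath E) : nat := size (fp_edges mu).

(* The boundary path space: singular-ended finite paths and infinite paths. *)
Inductive bpath : Type :=
| BFin (mu : fpath E) of singular (fp_rng mu)
| BInf of ipath E.

Definition bsrc (p : bpath) : vertex E :=
  match p with BFin mu _ => fp_src mu | BInf f => src (f 0%N) end.

Lemma fpath_eq (mu nu : fpath E) :
  fp_src mu = fp_src nu -> fp_edges mu = fp_edges nu -> mu = nu.
Proof.
case: mu nu => v l h [w m h'] /= vw lm; subst w m.
by rewrite (bool_irrelevance h h').
Qed.

Lemma ipath_eq (f g : ipath E) : f =1 g -> f = g.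
Proof.
case: f g => f hf [g hg] /= /funext fg; subst g.
by rewrite (Prop_irrelevance hf hg).
Qed.

Lemma BFin_eq (mu nu : fpath E) (hmu : singular (fp_rng mu)) (hnu : singular (fp_rng nu)) :
  mu = nu -> BFin hmu = BFin hnu.
Proof. by move=> e; subst nu; rewrite (Prop_irrelevance hmu hnu). Qed.

Section Cons.
Variable e : edge E.

Fact fcons_path (mu : fpath E) : rng e = fp_src mu -> is_path (src e) (e :: fp_edges mu).
Proof. by move=> h; rewrite /= eqxx /= h fp_path. Qed.
Definition fcons (mu : fpath E) (h : rng e = fp_src mu) : fpath E := FPath (fcons_path h).

Lemma fp_rng_fcons (mu : fpath E) (h : rng e = fp_src mu) : fp_rng (fcons h) = fp_rng mu.
Proof. by rewrite /fp_rng /= h. Qed.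

Fact icons_path (f : ipath E) : rng e = src (f 0%N) ->
  forall i, rng (if i is j.+1 then f j else e) = src (f i).
Proof. by move=> h [//|i]; exact: ip_path. Qed.
Definition icons (f : ipath E) (h : rng e = src (f 0%N)) : ipath E :=
  @IPath E (fun i => if i is j.+1 then f j else e) (icons_path h).

Definition bcons (p : bpath) : rng e = bsrc p -> bpath :=
  match p return rng e = bsrc p -> bpath with
  | BFin mu hmu => fun h =>
      @BFin (fcons h) (eq_ind_r singular hmu (fp_rng_fcons h))
  | BInf f => fun h => BInf (icons h)
  end.

(* e p if r(e) = s(p), None otherwise *)
Definition bpre (p : bpath) : option bpath :=
  if rng e =P bsrc p is ReflectT h then Some (bcons h) else None.

Lemma bsrc_bcons p (h : rng e = bsrc p) : bsrc (bcons h) = src e.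
Proof. by case: p h. Qed.

Lemma bpreE p (h : rng e = bsrc p) : bpre p = Some (bcons h).
Proof.
rewrite /bpre; case: eqP => // h'.
by rewrite (Prop_irrelevance h h').
Qed.

Lemma bpreP p q : bpre p = Some q -> exists h : rng e = bsrc p, q = bcons h.
Proof. by rewrite /bpre; case: eqP => // h [<-]; exists h. Qed.

Lemma bpre_isSome p : isSome (bpre p) = (rng e == bsrc p).
Proof. by rewrite /bpre; case: eqP. Qed.
End Cons.

Lemma bcons_inj e f p q (h : rng e = bsrc p) (h' : rng f = bsrc q) :
  bcons h = bcons h' -> e = f /\ p = q.
Proof.
case: p q h h' => [mu hmu|x] [nu hnu|y] h h' //= [].
  move=> _ ef ed; subst f; split=> //; apply: BFin_eq; apply: fpath_eq => //.
  exact: etrans (esym h) h'.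
move=> xy; split; first by have := congr1 (@^~ 0%N) xy.
by congr BInf; apply: ipath_eq => i; have := congr1 (@^~ i.+1) xy.
Qed.

Lemma bcons_surj q : ~ singular (bsrc q) ->
  exists e p (h : rng e = bsrc p), q = bcons h.
Proof.
case: q => [[v [|e l] hl] hs|f] /= ns; first by [].
  have [/eqP ev hl'] := andP (hl : (src e == v) && is_path (rng e) l).
  pose nu := FPath hl'.
  have hs' : singular (fp_rng nu) by exact: hs.
  exists e, (@BFin nu hs'), erefl; apply: BFin_eq; exact: fpath_eq.
pose g := @IPath E (fun i => f i.+1) (fun i => ip_path f i.+1).
exists (f 0%N), (BInf g), (ip_path f 0%N); congr BInf.
by apply: ipath_eq; case.
Qed.
End Paths.
Arguments bpath : clear implicits.

HB.instance Definition _ (E : digraph) := gen_eqMixin (bpath E).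
HB.instance Definition _ (E : digraph) := gen_choiceMixin (bpath E).

Section TailEquivalence.
Context {E : digraph}.
Implicit Types (mu nu : fpath E) (p q x y z : bpath E).

Definition bpre_seq (l : seq (edge E)) (p : bpath E) : option (bpath E) :=
  foldr (fun e => obind (bpre e)) (Some p) l.

(* mu p if r(mu) = s(p), None otherwise *)
Definition bcat (mu : fpath E) (p : bpath E) : option (bpath E) :=
  if fp_rng mu == bsrc p then bpre_seq (fp_edges mu) p else None.

(* x ~_k y *)
Definition tail_eq (x : bpath E) (k : int) (y : bpath E) : Prop :=
  exists mu nu p, [/\ bcat mu p = Some x, bcat nu p = Some y &
                      k = (fp_len mu)%:Z - (fp_len nu)%:Z].

Lemma bpre_seq_path l p x : bpre_seq l p = Some x ->
  is_path (bsrc x) l /\ last (bsrc x) (map (@rng E) l) = bsrc p.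
Proof.
elim: l x => [|e l IH] x /=; first by case=> ->.
case: (bpre_seq l p) IH => // y /(_ y erefl) [hp hl] /= /bpreP [h ->].
by rewrite bsrc_bcons eqxx /= h.
Qed.

Lemma bcatP l p x : bpre_seq l p = Some x ->
  exists2 mu : fpath E, fp_edges mu = l & bcat mu p = Some x.
Proof.
move=> hx; have [hp hl] := bpre_seq_path hx.
by exists (FPath hp); rewrite // /bcat /fp_rng /= hl eqxx.
Qed.

Lemma bcat_seq mu p x : bcat mu p = Some x -> bpre_seq (fp_edges mu) p = Some x.
Proof. by rewrite /bcat; case: ifP. Qed.

Lemma tail_eqP x k y : tail_eq x k y <->
  exists l m p, [/\ bpre_seq l p = Some x, bpre_seq m p = Some y &
                    k = (size l)%:Z - (size m)%:Z].
Proof.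
split=> [[mu [nu [p [/bcat_seq hx /bcat_seq hy ->]]]]|].
  by exists (fp_edges mu), (fp_edges nu), p.
case=> l [m [p [/bcatP [mu <- hx] /bcatP [nu <- hy] ->]]].
by exists mu, nu, p.
Qed.

Lemma tail_eq_refl x : tail_eq x 0 x.
Proof. by apply/tail_eqP; exists [::], [::], x; rewrite subrr. Qed.

Lemma tail_eq_sym x k y : tail_eq x k y -> tail_eq y (- k) x.
Proof.
by move=> [mu [nu [p [hx hy ->]]]]; exists nu, mu, p; rewrite opprB.
Qed.

Lemma bpre_seq_cat l m p : bpre_seq (l ++ m) p = obind (bpre_seq l) (bpre_seq m p).
Proof.
elim: l => [|e l IH] /=; first by case: bpre_seq.
by rewrite IH; case: bpre_seq.
Qed.

Lemma bpre_seq_split l m p q x : (size l <= size m)%N ->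
  bpre_seq l p = Some x -> bpre_seq m q = Some x ->
  exists2 b, m = l ++ b & bpre_seq b q = Some p.
Proof.
elim: l m x => [|e l IH] [|f m] x //= sz.
- by move=> -[->] [->]; exists [::].
- by move=> -[->] hm; exists (f :: m).
case hl : (bpre_seq l p) => [y|] //= /bpreP [h ->].
case hm : (bpre_seq m q) => [z|] //= /bpreP [h' eqx].
have [ef yz] := bcons_inj eqx; subst f z.
by have [b -> hb] := IH _ _ sz hl hm; exists b.
Qed.

Lemma tail_eq_trans x k y l z : tail_eq x k y -> tail_eq y l z -> tail_eq x (k + l) z.
Proof.
move=> /tail_eqP [s [t [p [hx hy ->]]]] /tail_eqP [t' [s' [q [hy' hz ->]]]].
apply/tail_eqP; case: (leqP (size t) (size t')) => sz.
  have [b eb hb] := bpre_seq_split sz hy hy'.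
  exists (s ++ b), s', q; rewrite bpre_seq_cat hb /= hx; split=> //.
  by rewrite eb !size_cat !PoszD; ring.
have [b eb hb] := bpre_seq_split (ltnW sz) hy' hy.
exists s, (s' ++ b), p; rewrite bpre_seq_cat hb /= hz; split=> //.
by rewrite eb !size_cat !PoszD; ring.
Qed.

Lemma tail_eq_bcons e p x k (h : rng e = bsrc p) :
  tail_eq p k x -> tail_eq (bcons h) (k + 1) x.
Proof.
move=> hp; rewrite addrC; apply: tail_eq_trans hp; apply/tail_eqP.
by exists [:: e], [::], p; rewrite /= (bpreE h) subr0.
Qed.
End TailEquivalence.

(* Arrows (x, k, y) of the graph groupoid, with x = gc and y = gd. *)
Record gpd (E : digraph) := Gpd {
  gc : bpath E;
  gk : int;
  gd : bpath E;
  gP : tail_eq gc gk gd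
}.

HB.instance Definition _ (E : digraph) := gen_eqMixin (gpd E).
HB.instance Definition _ (E : digraph) := gen_choiceMixin (gpd E).

Section Groupoid.
Context {E : digraph}.

Lemma gpd_eq (g h : gpd E) : gc g = gc h -> gk g = gk h -> gd g = gd h -> g = h.
Proof.
case: g h => x k y hg [x' k' y' hh] /= ? ? ?; subst x' k' y'.
by rewrite (Prop_irrelevance hg hh).
Qed.

Fact gmul_subproof (g h : gpd E) : gd g = gc h -> tail_eq (gc g) (gk g + gk h) (gd h).
Proof. by move=> e; apply: tail_eq_trans (gP g) _; rewrite e; exact: gP. Qed.
Definition gmul (g h : gpd E) (e : gd g = gc h) : gpd E := Gpd (gmul_subproof e).
Definition ginv (g : gpd E) : gpd E := Gpd (tail_eq_sym (gP g)).
Definition gunit (x : bpath E) : gpd E := Gpd (tail_eq_refl x).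

Variable x : bpath E.

Definition isotropy : Type := {g : gpd E | (gc g == x) && (gd g == x)}.
HB.instance Definition _ := Choice.on isotropy.
HB.instance Definition _ := SubType.on isotropy.

Lemma iso_c (g : isotropy) : gc (val g) = x.
Proof. by case/andP: (valP g) => /eqP. Qed.
Lemma iso_d (g : isotropy) : gd (val g) = x.
Proof. by case/andP: (valP g) => _ /eqP. Qed.
Lemma iso_eq (g h : isotropy) : gk (val g) = gk (val h) -> g = h.
Proof. by move=> e; apply/val_inj/gpd_eq; rewrite ?iso_c ?iso_d. Qed.

Fact iso_comp (g h : isotropy) : gd (val g) = gc (val h).
Proof. by rewrite iso_c iso_d. Qed.
Fact iso_mul_subproof (g h : isotropy) :
  (gc (gmul (iso_comp g h)) == x) && (gd (gmul (iso_comp g h)) == x).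
Proof. by rewrite /= iso_c iso_d eqxx. Qed.
Fact iso_inv_subproof (g : isotropy) : (gc (ginv (val g)) == x) && (gd (ginv (val g)) == x).
Proof. by rewrite /= iso_c iso_d eqxx. Qed.
Fact iso_one_subproof : (gc (gunit x) == x) && (gd (gunit x) == x).
Proof. by rewrite /= eqxx. Qed.

Definition iso_mul (g h : isotropy) : isotropy := exist (fun g => is_true ((gc g == x) && (gd g == x))) _ (iso_mul_subproof g h).
Definition iso_inv (g : isotropy) : isotropy := exist (fun g => is_true ((gc g == x) && (gd g == x))) _ (iso_inv_subproof g).
Definition iso_one : isotropy := exist (fun g => is_true ((gc g == x) && (gd g == x))) _ iso_one_subproof.

Fact iso_mulA : associative iso_mul.
Proof. by move=> g h k; apply: iso_eq; rewrite /= addrA. Qed.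
Fact iso_mul1g : left_id iso_one iso_mul.
Proof. by move=> g; apply: iso_eq; rewrite /= add0r. Qed.
Fact iso_mulg1 : right_id iso_one iso_mul.
Proof. by move=> g; apply: iso_eq; rewrite /= addr0. Qed.
Fact iso_mulVg : left_inverse iso_one iso_inv iso_mul.
Proof. by move=> g; apply: iso_eq; rewrite /= addNr. Qed.
Fact iso_mulgV : right_inverse iso_one iso_inv iso_mul.
Proof. by move=> g; apply: iso_eq; rewrite /= addrN. Qed.
HB.instance Definition _ := isGroup.Build isotropy
  iso_mulA iso_mul1g iso_mulg1 iso_mulVg iso_mulgV.

Definition Lfiber : Type := {g : gpd E | gd g == x}.
HB.instance Definition _ := Choice.on Lfiber.
HB.instance Definition _ := SubType.on Lfiber.

Lemma Lfiber_eq (g h : Lfiber) : gc (val g) = gc (val h) -> gk (val g) = gk (val h) -> g = h.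
Proof.
move=> ec ek; apply/val_inj/gpd_eq => //.
by rewrite (eqP (valP g)) (eqP (valP h)).
Qed.

Fact Lfiber_comp (l : Lfiber) (g : isotropy) : gd (val l) = gc (val g).
Proof. by rewrite iso_c; apply/eqP/(valP l). Qed.
Fact Lfiber_mul_subproof (l : Lfiber) (g : isotropy) : gd (gmul (Lfiber_comp l g)) == x.
Proof. by rewrite /= iso_d. Qed.
Definition Lfiber_mul (l : Lfiber) (g : isotropy) : Lfiber :=
  exist (fun g => is_true (gd g == x)) _ (Lfiber_mul_subproof l g).

(* the class [x] *)
Definition orbit_of : Type := {y : bpath E | `[< exists k, tail_eq y k x >]}.
HB.instance Definition _ := Choice.on orbit_of.
HB.instance Definition _ := SubType.on orbit_of.
End Groupoid.

Lemma linear_zero (K : fieldType) (U W : lmodType K) (f : U -> W) : linear f -> f 0 = 0.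
Proof. by move=> h; have := h (-1) 0 0; rewrite !scaleN1r !addNr. Qed.

Inductive lgen (E : digraph) : Type :=
| Lv of vertex E  (* v *)
| Le of edge E    (* e *)
| Ls of edge E.   (* the ghost edge e^* *)
Arguments Lv {E}.
Arguments Le {E}.
Arguments Ls {E}.
HB.instance Definition _ (E : digraph) := gen_eqMixin (lgen E).
HB.instance Definition _ (E : digraph) := gen_choiceMixin (lgen E).

Inductive leavitt_rel (E : digraph) (K : fieldType) (B : nualgType K) (f : lgen E -> B) :
  B -> B -> Prop :=
| lrel_vv v w : leavitt_rel f (f (Lv v) ** f (Lv w)) (if v == w then f (Lv v) else 0)
| lrel_ve e : leavitt_rel f (f (Lv (src e)) ** f (Le e)) (f (Le e))
| lrel_ev e : leavitt_rel f (f (Le e) ** f (Lv (rng e))) (f (Le e))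
| lrel_vs e : leavitt_rel f (f (Lv (rng e)) ** f (Ls e)) (f (Ls e))
| lrel_sv e : leavitt_rel f (f (Ls e) ** f (Lv (src e))) (f (Ls e))
| lrel_se e e' : leavitt_rel f (f (Ls e) ** f (Le e')) (if e == e' then f (Lv (rng e)) else 0)
| lrel_ck v : ~ singular v ->
    leavitt_rel f (f (Lv v)) (\sum_(e \in out_edges v) f (Le e) ** f (Ls e)).

Section LeavittAlgebra.
Context {K : fieldType} {E : digraph}.

Definition leavitt_relators : set (free_nualg K (lgen E)) :=
  [set r | exists u v, leavitt_rel (@free_gen K (lgen E)) u v /\ r = u - v].

Definition leavitt : nualgType K := aquot leavitt_relators.

Definition leavitt_gen (g : lgen E) : leavitt := pres_gen leavitt_relators g.

Definition leavitt_family (B : nualgType K) (f : lgen E -> B) : Prop :=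
  forall a b, leavitt_rel f a b -> a = b.

Lemma regular_finite (v : vertex E) : ~ singular v -> finite_set (out_edges v).
Proof. by move=> ns; apply: contrapT => h; apply: ns; right. Qed.

Lemma linear_fsbig (U W : lmodType K) (h : {linear U -> W}) (I : choiceType) (A : set I)
    (F : I -> U) : finite_set A ->
  h (\sum_(i \in A) F i) = \sum_(i \in A) h (F i).
Proof. by move=> fA; rewrite !fsbig_finite // raddf_sum. Qed.

Lemma leavitt_rel_morph (A B : nualgType K) (h : {linear A -> B}) (f : lgen E -> A)
    (g : lgen E -> B) : {morph h : a b / a ** b >-> a ** b} ->
  (forall x, h (f x) = g x) ->
  forall a b, leavitt_rel f a b -> leavitt_rel g (h a) (h b).
Proof.
move=> hM hf a b [v w|e|e|e|e|e e'|v ns]; rewrite ?hM ?hf; try by constructor.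
- by rewrite fun_if hf linear0; constructor.
- by rewrite fun_if hf linear0; constructor.
rewrite linear_fsbig; last exact: regular_finite.
rewrite (eq_fsbigr (fun e => g (Le e) ** g (Ls e))); last first.
  by move=> e _; rewrite hM !hf.
by constructor.
Qed.

Lemma leavitt_genP : leavitt_family leavitt_gen.
Proof.
have apiP a b : leavitt_rel (@free_gen K (lgen E)) a b ->
    api leavitt_relators a = api leavitt_relators b.
  by move=> h; apply: api_gen; exists a, b.
move=> _ _ [v w|e|e|e|e|e e'|v ns];
  rewrite /leavitt_gen /pres_gen -?apiM; try by apply: apiP; constructor.
- by rewrite (apiP _ _ (lrel_vv _ v w)); case: ifP => // _; rewrite linear0.
- by rewrite (apiP _ _ (lrel_se _ e e')); case: ifP => // _; rewrite linear0.
rewrite (apiP _ _ (lrel_ck _ ns)) linear_fsbig; last exact: regular_finite.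
by apply: eq_fsbigr => e _; exact: apiM.
Qed.

Section Lift.
Context {B : nualgType K} (f : lgen E -> B).
Hypothesis hf : leavitt_family f.

Fact leavitt_lift_subproof r : leavitt_relators r -> feval f r = 0.
Proof.
move=> [u [v [uv ->]]]; rewrite linearB; apply/eqP; rewrite subr_eq0; apply/eqP.
apply: hf; apply: (leavitt_rel_morph _ _ uv); last exact: feval_gen.
exact: fevalM.
Qed.

Definition leavitt_lift : {linear leavitt -> B} := pres_lift leavitt_lift_subproof.

Lemma leavitt_liftM a b : leavitt_lift (a ** b) = leavitt_lift a ** leavitt_lift b.
Proof. exact: pres_liftM. Qed.
Lemma leavitt_lift_gen g : leavitt_lift (leavitt_gen g) = f g.
Proof. exact: pres_lift_gen. Qed.
End Lift.

Lemma leavitt_ind (P : leavitt -> Prop) :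
  P 0 -> (forall k u v, P u -> P v -> P (k *: u + v)) ->
  (forall u v, P u -> P v -> P (u ** v)) ->
  (forall x, P (leavitt_gen x)) -> forall u, P u.
Proof. exact: pres_ind. Qed.

Definition leavitt_path (mu : fpath E) : leavitt :=
  foldr (fun e u => leavitt_gen (Le e) ** u) (leavitt_gen (Lv (fp_rng mu))) (fp_edges mu).
Definition leavitt_star (nu : fpath E) : leavitt :=
  foldr (fun e u => u ** leavitt_gen (Ls e)) (leavitt_gen (Lv (fp_rng nu))) (fp_edges nu).
Definition leavitt_mono (mu nu : fpath E) : leavitt := leavitt_path mu ** leavitt_star nu.
End LeavittAlgebra.
Arguments leavitt : clear implicits.
Arguments leavitt_gen K {E}.

Section BaseChange.
Context {K K' : fieldType} (iota : {rmorphism K -> K'}) {E : digraph}.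

Definition base_gen (g : lgen E) : restr iota (leavitt K' E) := leavitt_gen K' g.

Fact base_genP : leavitt_family base_gen.
Proof.
move=> _ _ [v w|e|e|e|e|e e'|v ns].
- exact: leavitt_genP (lrel_vv _ v w).
- exact: leavitt_genP (lrel_ve _ e).
- exact: leavitt_genP (lrel_ev _ e).
- exact: leavitt_genP (lrel_vs _ e).
- exact: leavitt_genP (lrel_sv _ e).
- exact: leavitt_genP (lrel_se _ e e').
- exact: leavitt_genP (lrel_ck _ ns).
Qed.

Definition base_change : {linear leavitt K E -> restr iota (leavitt K' E)} :=
  leavitt_lift base_genP.

Section RestrictModule.
Variable M : leftModule (leavitt K' E).

Definition restr_act (u : leavitt K E) (m : restr iota M) : restr iota M :=
  lact (base_change u : leavitt K' E) (m : M).

Fact restr_act_linearl m : linear (fun u => restr_act u m).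
Proof.
by move=> k u v; rewrite /restr_act linearP restrZ; exact: lact_linearl.
Qed.
Fact restr_act_linearr u : linear (restr_act u).
Proof. by move=> k m m'; rewrite /restr_act !restrZ; exact: lact_linearr. Qed.
Fact restr_actM u v m : restr_act (u ** v) m = restr_act u (restr_act v m).
Proof. by rewrite /restr_act leavitt_liftM; exact: lactM. Qed.

Definition restr_module : leftModule (leavitt K E) :=
  LeftModule restr_act_linearl restr_act_linearr restr_actM.
End RestrictModule.
End BaseChange.

Section Twist.
Context {K : fieldType} {E : digraph} (a : edge E -> K).
Hypothesis a_neq0 : forall e, a e != 0.

Definition sigma_gen (g : lgen E) : leavitt K E :=
  match g with
  | Lv v => leavitt_gen K (Lv v)
  | Le e => a e *: leavitt_gen K (Le e)
  | Ls e => (a e)^-1 *: leavitt_gen K (Ls e)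
  end.

Fact sigma_genP : leavitt_family sigma_gen.
Proof.
move=> _ _ [v w|e|e|e|e|e e'|v ns] /=.
- exact: leavitt_genP (lrel_vv _ v w).
- by rewrite nmulZr (leavitt_genP (lrel_ve _ e)).
- by rewrite nmulZl (leavitt_genP (lrel_ev _ e)).
- by rewrite nmulZr (leavitt_genP (lrel_vs _ e)).
- by rewrite nmulZl (leavitt_genP (lrel_sv _ e)).
- rewrite nmulZl nmulZr (leavitt_genP (lrel_se _ e e')).
  by case: eqP => [<-|_]; rewrite ?scaler0 // scalerA mulVf // scale1r.
rewrite (leavitt_genP (lrel_ck _ ns)); apply: eq_fsbigr => e _.
by rewrite nmulZl nmulZr scalerA mulfV // scale1r.
Qed.

Definition sigma : {linear leavitt K E -> leavitt K E} := leavitt_lift sigma_genP.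

Variable M : leftModule (leavitt K E).

Definition twist_act (u : leavitt K E) (m : M) : M := lact (sigma u) m.

Fact twist_act_linearl m : linear (fun u => twist_act u m).
Proof. by move=> k u v; rewrite /twist_act linearP; exact: lact_linearl. Qed.
Fact twist_act_linearr u : linear (twist_act u).
Proof. exact: lact_linearr. Qed.
Fact twist_actM u v m : twist_act (u ** v) m = twist_act u (twist_act v m).
Proof. by rewrite /twist_act leavitt_liftM; exact: lactM. Qed.

Definition twist_module : leftModule (leavitt K E) :=
  LeftModule twist_act_linearl twist_act_linearr twist_actM.
End Twist.

(* An algebraic branching system: X behaves like a set of boundary paths, with
   source br_src x, and br_pre e x is "ex", defined when r(e) = br_src x.  It
   makes the space with basis X an L_K(E)-module; both V_[x] and KL_x arise in
   this way, and chen_act, chen_act0, KL_act, KL_act0 below show that their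
   actions are the usual ones on the spanning elements mu nu^*. *)
Record branching (E : digraph) (X : choiceType) := Branching {
  br_src : X -> vertex E;
  br_pre : edge E -> X -> option X;
  br_pre_dom : forall e x, isSome (br_pre e x) = (rng e == br_src x);
  br_pre_src : forall e x y, br_pre e x = Some y -> br_src y = src e;
  br_pre_inj : forall e e' x x' y,
    br_pre e x = Some y -> br_pre e' x' = Some y -> e = e' /\ x = x';
  br_pre_surj : forall y, ~ singular (br_src y) -> exists e x, br_pre e x = Some y
}.

Definition pinv (X Y : Type) (f : X -> option Y) (y : Y) : option X :=
  if pselect (exists x, f x = Some y) is left h then Some (projT1 (cid h)) else None.

Lemma pinvP (X Y : Type) (f : X -> option Y) (y : Y) x : pinv f y = Some x -> f x = Some y.
Proof. by rewrite /pinv; case: pselect => // h [<-]; exact: (projT2 (cid h)). Qed.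

Lemma pinv_eq (X Y : Type) (f : X -> option Y) (y : Y) x :
  (forall x' , f x' = Some y -> x' = x) -> f x = Some y -> pinv f y = Some x.
Proof.
move=> inj fx; rewrite /pinv; case: pselect => [h|[]]; last by exists x.
by congr Some; exact: inj (projT2 (cid h)).
Qed.

Lemma pinv_none (X Y : Type) (f : X -> option Y) (y : Y) :
  (forall x, f x <> Some y) -> pinv f y = None.
Proof. by move=> h; rewrite /pinv; case: pselect => // hx; exfalso; case: hx. Qed.

Section BranchingModule.
Context {K : fieldType} {E : digraph} {X : choiceType} (b : branching E X).

(* v.x = x if v = s(x), e.x = ex if r(e) = s(x), e^*.x = x' if x = ex', and 0 otherwise *)
Definition br_gen (g : lgen E) (x : X) : option X :=
  match g with
  | Lv v => if br_src b x == v then Some x else None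
  | Le e => br_pre b e x
  | Ls e => pinv (br_pre b e) x
  end.

Definition obasis (o : option X) : {malg K[X]} := if o is Some x then << x >> else 0.

Definition pmap_lend (f : X -> option X) : lend {malg K[X]} :=
  Lend (lext_is_linear (fun x => obasis (f x))).

Arguments pmap_lend : simpl never.

Lemma pmap_lendU f x : pmap_lend f << x >> = obasis (f x).
Proof. exact: lextU. Qed.

Lemma lend_basis (f g : lend {malg K[X]}) : (forall x : X, f << x >> = g << x >>) -> f = g.
Proof.
move=> fg; apply: lendP => u; elim/(@malg_ind K X): u => [|k u v fu fv|x].
- by rewrite !linear0.
- by rewrite !lend_linear fu fv.
- exact: fg.
Qed.

Lemma pmap_lendM f g x : (pmap_lend f ** pmap_lend g) << x >> = obasis (obind f (g x)).
Proof.
rewrite lendME pmap_lendU; case: (g x) => [y|] /=; first exact: pmap_lendU.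
exact: linear0.
Qed.

Definition br_lend (g : lgen E) : lend {malg K[X]} := pmap_lend (br_gen g).
Arguments br_lend : simpl never.

Lemma br_lendU g x : br_lend g << x >> = obasis (br_gen g x).
Proof. exact: pmap_lendU. Qed.

Lemma br_inj e x x' y : br_pre b e x = Some y -> br_pre b e x' = Some y -> x' = x.
Proof. by move=> h h'; case: (br_pre_inj h h'). Qed.

Lemma br_pinv e x y : br_pre b e x = Some y -> pinv (br_pre b e) y = Some x.
Proof. by move=> h; apply: pinv_eq => // x'; apply: br_inj. Qed.

Fact br_lendP : leavitt_family br_lend.
Proof.
move=> _ _ [v w|e|e|e|e|e e'|v ns].
- apply: lend_basis => x; rewrite pmap_lendM [br_gen _ x]/=.
  have [vw|vw] := eqVneq v w; first rewrite br_lendU -vw [br_gen _ x]/=.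
    by have [xv|] := eqVneq (br_src b x) v; rewrite //= xv eqxx.
  have [xw|//] := eqVneq (br_src b x) w.
  by rewrite /= xw eq_sym (negPf vw).
- apply: lend_basis => x; rewrite pmap_lendM br_lendU /=.
  by case h : br_pre => [y|] //=; rewrite (br_pre_src h) eqxx.
- apply: lend_basis => x; rewrite pmap_lendM br_lendU /= eq_sym.
  rewrite -(br_pre_dom b e x).
  by case h : br_pre => [y|] //=; rewrite h.
- apply: lend_basis => x; rewrite pmap_lendM br_lendU /=.
  case h : pinv => [y|] //=; have := br_pre_dom b e y.
  by rewrite (pinvP h) /= eq_sym => <-.
- apply: lend_basis => x; rewrite pmap_lendM br_lendU /=.
  case: eqP => //= ne; case h : pinv => [y|] //.
  by case: ne; rewrite (br_pre_src (pinvP h)).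
- apply: lend_basis => x; rewrite pmap_lendM [br_gen _ x]/=.
  have [<-|ne] := eqVneq e e'; last first.
    case h : br_pre => [y|] //=; rewrite pinv_none // => z h'.
    by have [ee] := br_pre_inj h h'; rewrite ee eqxx in ne.
  rewrite br_lendU /= eq_sym -(br_pre_dom b e x).
  by case h : br_pre => [y|] //=; rewrite (br_pinv h).
apply: lend_basis => x; rewrite br_lendU /=.
pose ev (f : lend {malg K[X]}) : {malg K[X]} := f << x >>.
have evl : linear ev by [].
pose ev' : {linear lend {malg K[X]} -> {malg K[X]}} :=
  HB.pack ev (GRing.isLinear.Build K _ _ _ ev evl).
have fin := regular_finite ns.
have term e : (br_lend (Le e) ** br_lend (Ls e)) << x >> =
    if `[< exists y, br_pre b e y = Some x >] then << x >> else 0.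
  rewrite pmap_lendM /=; case: asboolP => [[y h]|h].
    by rewrite (br_pinv h) /= h.
  by rewrite pinv_none //= => y h'; apply: h; exists y.
rewrite -[RHS]/(ev' _) linear_fsbig //.
rewrite (eq_fsbigr (fun e => if `[< exists y, br_pre b e y = Some x >] then << x >> else 0));
  last by move=> e _; exact: term.
case: (eqVneq (br_src b x) v) => [xv|xv] /=; last first.
  rewrite fsbig1 // => e ev0; case: asboolP => // -[y /br_pre_src h].
  by case/eqP: xv; rewrite h.
rewrite -xv in ns fin *.
have [e [y h]] := br_pre_surj ns.
rewrite (fsbigD1 e) //; last by rewrite /out_edges /= (br_pre_src h).
case: asboolP => [_|[]]; last by exists y.
rewrite fsbig1 => [|e' [_ ne]]; first by rewrite /= addr0.
case: asboolP => // -[y' h'].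
by case: (br_pre_inj h h') => /esym/ne.
Qed.

Definition br_act (u : leavitt K E) (m : {malg K[X]}) : {malg K[X]} :=
  leavitt_lift br_lendP u m.

Fact br_act_linearl m : linear (fun u => br_act u m).
Proof. by move=> k u v; rewrite /br_act linearP. Qed.
Fact br_act_linearr u : linear (br_act u).
Proof. by move=> k m n; rewrite /br_act linearP. Qed.
Fact br_actM u v m : br_act (u ** v) m = br_act u (br_act v m).
Proof. by rewrite /br_act leavitt_liftM. Qed.

Lemma br_act0 u : br_act u 0 = 0.
Proof. exact: linear0. Qed.

Definition br_module : leftModule (leavitt K E) :=
  LeftModule br_act_linearl br_act_linearr br_actM.

Lemma br_act_gen g x : br_act (leavitt_gen K g) << x >> = obasis (br_gen g x).
Proof. by rewrite /br_act leavitt_lift_gen br_lendU. Qed.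

Definition br_cat (mu : fpath E) (x : X) : option X :=
  if fp_rng mu == br_src b x then
    foldr (fun e => obind (br_pre b e)) (Some x) (fp_edges mu)
  else None.

Lemma br_act_path mu x : br_act (leavitt_path mu) << x >> = obasis (br_cat mu x).
Proof.
rewrite /leavitt_path /br_cat; case: eqP => h.
  elim: (fp_edges mu) => [|e l IH] /=; first by rewrite br_act_gen /= h eqxx.
  rewrite br_actM IH; case: foldr => [y|] /=; first exact: br_act_gen.
  exact: br_act0.
elim: (fp_edges mu) => [|e l IH] /=.
  by rewrite br_act_gen /=; case: eqP => // /esym.
by rewrite br_actM IH; exact: br_act0.
Qed.

Lemma br_act_star nu x y : br_cat nu x = Some y -> br_act (leavitt_star nu) << y >> = << x >>.
Proof.
rewrite /leavitt_star /br_cat; case: eqP => // h.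
elim: (fp_edges nu) y => [|e l IH] y /=; first by case=> <-; rewrite br_act_gen /= h eqxx.
case h' : foldr => [z|] //= hz; rewrite br_actM br_act_gen /= (br_pinv hz).
exact: IH.
Qed.

Lemma br_act_star0 nu y : (forall x, br_cat nu x <> Some y) ->
  br_act (leavitt_star nu) << y >> = 0.
Proof.
rewrite /leavitt_star /br_cat.
elim: (fp_edges nu) y => [|e l IH] y /= hy.
  rewrite br_act_gen /=; case: eqP => // h.
  by case: (hy y); rewrite h eqxx.
rewrite br_actM br_act_gen /=; case h : pinv => [z|] /=; last exact: br_act0.
apply: IH => x hx; case: (hy x); move: hx; case: eqP => // _ -> /=.
exact: pinvP h.
Qed.

Lemma br_act_mono mu nu x y : br_cat nu x = Some y ->
  br_act (leavitt_mono mu nu) << y >> = obasis (br_cat mu x).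
Proof. by move=> h; rewrite br_actM (br_act_star h) br_act_path. Qed.

Lemma br_act_mono0 mu nu y : (forall x, br_cat nu x <> Some y) ->
  br_act (leavitt_mono mu nu) << y >> = 0.
Proof. by move=> h; rewrite br_actM (br_act_star0 h); exact: br_act0. Qed.
End BranchingModule.

Section Chen.
Context {E : digraph} (x : bpath E).

Fact orbit_pre_subproof e (y : orbit_of x) (h : rng e = bsrc (val y)) :
  `[< exists k, tail_eq (bcons h) k x >].
Proof.
have [k hk] := asboolP _ (valP y).
by apply/asboolP; exists (k + 1); exact: tail_eq_bcons.
Qed.

Definition orbit_pre (e : edge E) (y : orbit_of x) : option (orbit_of x) :=
  if rng e =P bsrc (val y) is ReflectT h
  then Some (exist (fun z => is_true `[< exists k, tail_eq z k x >]) _ (orbit_pre_subproof h))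
  else None.

Lemma orbit_preP e y z : orbit_pre e y = Some z -> bpre e (val y) = Some (val z).
Proof. by rewrite /orbit_pre /bpre; case: eqP => // h [<-]. Qed.

Lemma orbit_pre_val e y z : bpre e (val y) = Some (val z) -> orbit_pre e y = Some z.
Proof.
by rewrite /orbit_pre /bpre; case: eqP => // h [hz]; congr Some; exact: val_inj.
Qed.

Fact orbit_pre_dom e y : isSome (orbit_pre e y) = (rng e == bsrc (val y)).
Proof. by rewrite /orbit_pre; case: eqP. Qed.

Fact orbit_pre_src e y z : orbit_pre e y = Some z -> bsrc (val z) = src e.
Proof. by move=> /orbit_preP /bpreP [h ->]; exact: bsrc_bcons. Qed.

Fact orbit_pre_inj e e' y y' z :
  orbit_pre e y = Some z -> orbit_pre e' y' = Some z -> e = e' /\ y = y'.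
Proof.
move=> /orbit_preP /bpreP [h hz] /orbit_preP /bpreP [h' hz'].
rewrite hz in hz'; have [-> /val_inj ->] := bcons_inj hz'; by [].
Qed.

Fact orbit_pre_surj (z : orbit_of x) : ~ singular (bsrc (val z)) ->
  exists e y, orbit_pre e y = Some z.
Proof.
move=> /bcons_surj [e [p [h hz]]]; have [k hk] := asboolP _ (valP z).
have hp : `[< exists k, tail_eq p k x >].
  apply/asboolP; exists (- 1 + k); apply: tail_eq_trans hk.
  apply/tail_eqP; exists [::], [:: e], p; split=> //=.
  by rewrite hz (bpreE h).
exists e, (exist (fun z => is_true `[< exists k, tail_eq z k x >]) p hp).
by apply: orbit_pre_val; rewrite /= hz (bpreE h).
Qed.

Definition chen_branching : branching E (orbit_of x) :=
  @Branching E _ (fun y => bsrc (val y)) orbit_pre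
    orbit_pre_dom orbit_pre_src orbit_pre_inj orbit_pre_surj.

Lemma orbit_cat mu (p q : orbit_of x) :
  br_cat chen_branching mu p = Some q <-> bcat mu (val p) = Some (val q).
Proof.
rewrite /br_cat /bcat /bpre_seq /=; case: eqP => // _.
elim: (fp_edges mu) q => [|e l IH] q /=.
  by split=> [[->]|[/val_inj ->]].
split.
  case h : foldr => [y|] //= /orbit_preP hy.
  by have -> := (IH y).1 h.
case h : foldr => [y|] //= hy.
suff [y' yy'] : exists y' : orbit_of x, val y' = y.
  by rewrite -yy' in h hy; rewrite ((IH y').2 h) /=; exact: orbit_pre_val.
have [k hk] := asboolP _ (valP q).
have hp : `[< exists k, tail_eq y k x >].
  apply/asboolP; exists (- 1 + k); apply: tail_eq_trans hk.
  by apply/tail_eqP; exists [::], [:: e], y; split=> //=; rewrite sub0r.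
by exists (exist (fun z => is_true `[< exists k, tail_eq z k x >]) y hp).
Qed.

Definition chen_module (K : fieldType) : leftModule (leavitt K E) := br_module chen_branching.

(* mu nu^* . p = mu p' if p = nu p', and 0 otherwise. *)
Lemma chen_act (K : fieldType) mu nu (p q : orbit_of x) (p' : bpath E) :
  bcat nu p' = Some (val p) -> bcat mu p' = Some (val q) ->
  lact (leavitt_mono mu nu) (<< p >> : chen_module K) = << q >>.
Proof.
move=> hp hq; have hp' : `[< exists k, tail_eq p' k x >].
  have [k hk] := asboolP _ (valP p).
  apply/asboolP; exists (- (fp_len nu)%:Z + k); apply: tail_eq_trans hk.
  apply/tail_eqP; exists [::], (fp_edges nu), p'; split=> //; last by rewrite sub0r.
  exact: bcat_seq.
pose p1 : orbit_of x := exist (fun z => is_true `[< exists k, tail_eq z k x >]) p' hp'.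
have h1 : br_cat chen_branching nu p1 = Some p by apply/orbit_cat.
have h2 : br_cat chen_branching mu p1 = Some q by apply/orbit_cat.
by have := br_act_mono (K := K) mu h1; rewrite h2.
Qed.

Lemma chen_act0 (K : fieldType) mu nu (p : orbit_of x) :
  (forall p', bcat nu p' <> Some (val p)) ->
  lact (leavitt_mono mu nu) (<< p >> : chen_module K) = 0.
Proof. by move=> h; apply: br_act_mono0 => q /orbit_cat /h. Qed.
End Chen.

Section Induction.
Context {E : digraph} (x : bpath E).

Fact Lfiber_pre_subproof e (l : Lfiber x) (h : rng e = bsrc (gc (val l))) :
  gd (Gpd (tail_eq_bcons h (gP (val l)))) == x.
Proof. exact: (valP l). Qed.

Definition Lfiber_pre (e : edge E) (l : Lfiber x) : option (Lfiber x) :=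
  if rng e =P bsrc (gc (val l)) is ReflectT h
  then Some (exist (fun g => is_true (gd g == x)) _ (Lfiber_pre_subproof h))
  else None.

Lemma Lfiber_preP e l m : Lfiber_pre e l = Some m <->
  bpre e (gc (val l)) = Some (gc (val m)) /\ gk (val m) = gk (val l) + 1.
Proof.
rewrite /Lfiber_pre /bpre; case: eqP => [h|h]; last by split=> // -[].
split=> [[<-] //|[[hc] hk]]; congr Some; exact: Lfiber_eq.
Qed.

Fact Lfiber_pre_dom e l : isSome (Lfiber_pre e l) = (rng e == bsrc (gc (val l))).
Proof. by rewrite /Lfiber_pre; case: eqP. Qed.

Fact Lfiber_pre_src e l m : Lfiber_pre e l = Some m -> bsrc (gc (val m)) = src e.
Proof. by move=> /Lfiber_preP [/bpreP [h ->] _]; exact: bsrc_bcons. Qed.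

Fact Lfiber_pre_inj e e' l l' m :
  Lfiber_pre e l = Some m -> Lfiber_pre e' l' = Some m -> e = e' /\ l = l'.
Proof.
move=> /Lfiber_preP [/bpreP [h hz] hk] /Lfiber_preP [/bpreP [h' hz'] hk'].
rewrite hz in hz'; have [-> hc] := bcons_inj hz'; split=> //.
by apply: Lfiber_eq hc _; apply: (addIr 1); rewrite -hk -hk'.
Qed.

Lemma Lfiber_mk (y : bpath E) k : tail_eq y k x ->
  exists l : Lfiber x, gc (val l) = y /\ gk (val l) = k.
Proof. by move=> h; exists (exist (fun g => is_true (gd g == x)) (Gpd h) (eqxx x)). Qed.

Lemma Lfiber_tail (l : Lfiber x) : tail_eq (gc (val l)) (gk (val l)) x.
Proof. by have := gP (val l); rewrite (eqP (valP l)). Qed.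

Fact Lfiber_pre_surj (m : Lfiber x) : ~ singular (bsrc (gc (val m))) ->
  exists e l, Lfiber_pre e l = Some m.
Proof.
move=> /bcons_surj [e [p [h hz]]].
have [|l [hc hk]] := @Lfiber_mk p (- 1 + gk (val m)).
  apply: tail_eq_trans (Lfiber_tail m); apply/tail_eqP; exists [::], [:: e], p.
  by split=> //=; rewrite hz (bpreE h).
exists e, l; apply/Lfiber_preP; rewrite hc hk hz (bpreE h); split=> //.
by rewrite addrAC addNr add0r.
Qed.

Definition Lfiber_branching : branching E (Lfiber x) :=
  @Branching E _ (fun l => bsrc (gc (val l))) Lfiber_pre
    Lfiber_pre_dom Lfiber_pre_src Lfiber_pre_inj Lfiber_pre_surj.

Lemma Lfiber_cat mu (l m : Lfiber x) :
  br_cat Lfiber_branching mu l = Some m <->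
  bcat mu (gc (val l)) = Some (gc (val m)) /\ gk (val m) = gk (val l) + (fp_len mu)%:Z.
Proof.
rewrite /br_cat /bcat /bpre_seq /fp_len /=; case: eqP => [_|]; last by split=> // -[].
elim: (fp_edges mu) m => [|e s IH] m /=.
  split=> [[->]|[[hc] hk]]; first by rewrite addr0.
  by congr Some; apply: Lfiber_eq; rewrite // hk addr0.
split.
  case h : foldr => [y|] //= /Lfiber_preP [hy hk].
  by have [-> hk'] := (IH y).1 h; rewrite hk hk' -addrA -PoszD addn1.
case; case h : foldr => [y|] //= hy hk.
have [|n [hc hn]] := @Lfiber_mk y (- 1 + gk (val m)).
  apply: tail_eq_trans (Lfiber_tail m); apply/tail_eqP; exists [::], [:: e], y.
  by split=> //=; rewrite sub0r.
rewrite -hc in h hy; rewrite ((IH n).2 _) /=.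
  by apply/Lfiber_preP; split=> //; rewrite hn addrAC addNr add0r.
by split=> //; rewrite hn hk -[in _.+1%:Z]addn1 PoszD; ring.
Qed.

Section Bimodule.
Variable K : fieldType.

Definition KL_left : leftModule (leavitt K E) := br_module Lfiber_branching.

Fact KL_key : unit. Proof. exact: tt. Qed.
Definition KL_ract : KL_left -> salg K (isotropy x) -> KL_left :=
  locked_with KL_key
    (fun m b => lext (fun l => slext (fun g => << Lfiber_mul l g >> : KL_left) b) m).

Lemma KL_ractU (l : Lfiber x) (g : isotropy x) : KL_ract << l >> (sbasis g) = << Lfiber_mul l g >>.
Proof. by rewrite /KL_ract unlock lextU slextU. Qed.

Fact KL_ract_linearl b : linear (fun m => KL_ract m b).
Proof. rewrite /KL_ract unlock; exact: linearP. Qed.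
Fact KL_ract_linearr m : linear (KL_ract m).
Proof.
rewrite /KL_ract unlock; exact: (lext_linearr (fun l g => << Lfiber_mul l g >> : KL_left)).
Qed.

Lemma KL_ractPl b k m n : KL_ract (k *: m + n) b = k *: KL_ract m b + KL_ract n b.
Proof. exact: KL_ract_linearl. Qed.
Lemma KL_ractPr m k b c : KL_ract m (k *: b + c) = k *: KL_ract m b + KL_ract m c.
Proof. exact: KL_ract_linearr. Qed.
Lemma KL_ract0l b : KL_ract 0 b = 0.
Proof. exact: linear_zero (KL_ract_linearl b). Qed.
Lemma KL_ract0r m : KL_ract m 0 = 0.
Proof. exact: linear_zero (KL_ract_linearr m). Qed.

Lemma Lfiber_mulA (l : Lfiber x) (g h : isotropy x) : Lfiber_mul l (g * h)%g = Lfiber_mul (Lfiber_mul l g) h.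
Proof. by apply: Lfiber_eq => //=; rewrite addrA. Qed.

Fact KL_ractM m b c : KL_ract m (b ** c) = KL_ract (KL_ract m b) c.
Proof.
elim/(@malg_ind K (Lfiber x)): m => [|k m n IHm IHn|l].
- by rewrite !KL_ract0l.
- by rewrite !KL_ractPl IHm IHn.
elim/(@salg_ind K (isotropy x)): b => [|k b b' IHb IHb'|g].
- by rewrite nmul0r !KL_ract0r KL_ract0l.
- by rewrite nmulPl (KL_ractPr _ k (b ** c)) IHb IHb' (KL_ractPr _ k b) KL_ractPl.
elim/(@salg_ind K (isotropy x)): c => [|k c c' IHc IHc'|h].
- by rewrite nmulr0 !KL_ract0r.
- by rewrite nmulPr (KL_ractPr _ k (sbasis g ** c)) IHc IHc' -KL_ractPr.
by rewrite (KL_ractU l g) (KL_ractU _ h) -Lfiber_mulA -KL_ractU -sbasisM.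
Qed.

Lemma Lfiber_preM e (l : Lfiber x) (g : isotropy x) m : Lfiber_pre e l = Some m ->
  Lfiber_pre e (Lfiber_mul l g) = Some (Lfiber_mul m g).
Proof.
move=> /Lfiber_preP [hc hk]; apply/Lfiber_preP; rewrite /= hc hk; split=> //.
by rewrite addrAC.
Qed.

Lemma Lfiber_mulgV (l : Lfiber x) (g : isotropy x) : Lfiber_mul (Lfiber_mul l g) g^-1%g = l.
Proof. by apply: Lfiber_eq => //=; rewrite addrK. Qed.

Lemma Lfiber_pre_none e (l : Lfiber x) (g : isotropy x) : Lfiber_pre e l = None -> Lfiber_pre e (Lfiber_mul l g) = None.
Proof.
move=> h; case h' : Lfiber_pre => [m|] //.
by have := Lfiber_preM g^-1%g h'; rewrite Lfiber_mulgV h.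
Qed.

Lemma Lfiber_genM (t : lgen E) (l : Lfiber x) (g : isotropy x) :
  br_gen Lfiber_branching t (Lfiber_mul l g) =
  omap (fun m => Lfiber_mul m g) (br_gen Lfiber_branching t l).
Proof.
case: t => [v|e|e] /=; first by case: eqP.
  case h : (Lfiber_pre e l) => [m|] /=; first exact: Lfiber_preM h.
  exact: Lfiber_pre_none h.
case h : (pinv (Lfiber_pre e) l) => [m|] /=.
  have hm := Lfiber_preM g (pinvP h).
  exact: (@br_pinv E _ Lfiber_branching e _ _ hm).
apply: pinv_none => m hm; have := Lfiber_preM g^-1%g hm; rewrite Lfiber_mulgV => hl.
by have := @br_pinv E _ Lfiber_branching e _ _ hl; rewrite /= h.
Qed.

Fact KL_actC (u : leavitt K E) m b : KL_ract (lact u m : KL_left) b = lact u (KL_ract m b).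
Proof.
have l0 v : lact v (0 : KL_left) = 0 by exact: br_act0.
have lP v k (p q : KL_left) : lact v (k *: p + q) = k *: lact v p + lact v q.
  exact: lact_linearr.
have Pl (p : KL_left) k v w : lact (k *: v + w) p = k *: lact v p + lact w p.
  exact: lact_linearl.
elim/(@leavitt_ind K E): u m b => [|k u v IHu IHv|u v IHu IHv|t] m b.
- have z (p : KL_left) : lact 0 p = 0.
    exact: linear_zero (lact_linearl p).
  by rewrite !z KL_ract0l.
- by rewrite !Pl KL_ractPl IHu IHv.
- by rewrite !lactM IHu IHv.
elim/(@malg_ind K (Lfiber x)): m => [|k m n IHm IHn|l].
- by rewrite l0 KL_ract0l l0.
- by rewrite lP !KL_ractPl lP IHm IHn.
elim/(@salg_ind K (isotropy x)): b => [|k c c' IHb IHb'|g].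
- by rewrite !KL_ract0r l0.
- by rewrite !KL_ractPr lP IHb IHb'.
rewrite KL_ractU.
have actE (l' : Lfiber x) : lact (leavitt_gen K t) (<< l' >> : KL_left) =
    obasis (br_gen Lfiber_branching t l') by exact: br_act_gen.
rewrite !actE Lfiber_genM; case: br_gen => [m|] /=; first exact: KL_ractU.
exact: KL_ract0l.
Qed.

Definition KL : bimodule (leavitt K E) (salg K (isotropy x)) :=
  @Bimodule K (leavitt K E) (salg K (isotropy x)) KL_left KL_ract
    KL_ract_linearl KL_ract_linearr KL_ractM KL_actC.

(* mu nu^* . (y, k, x) = (mu p, |mu| - |nu| + k, x) if y = nu p, and 0 otherwise. *)
Lemma KL_act mu nu (l m : Lfiber x) (p : bpath E) :
  bcat nu p = Some (gc (val l)) -> bcat mu p = Some (gc (val m)) ->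
  gk (val m) = (fp_len mu)%:Z - (fp_len nu)%:Z + gk (val l) ->
  lact (leavitt_mono mu nu) (<< l >> : KL_left) = << m >>.
Proof.
move=> hl hm hk.
have [|n [hc hn]] := @Lfiber_mk p (- (fp_len nu)%:Z + gk (val l)).
  apply: tail_eq_trans (Lfiber_tail l).
  apply/tail_eqP; exists [::], (fp_edges nu), p; split=> //; last by rewrite sub0r.
  exact: bcat_seq.
rewrite -hc in hl hm.
have h1 : br_cat Lfiber_branching nu n = Some l.
  by apply/Lfiber_cat; split=> //; rewrite hn; ring.
have h2 : br_cat Lfiber_branching mu n = Some m.
  by apply/Lfiber_cat; split=> //; rewrite hn hk; ring.
by have := br_act_mono (K := K) mu h1; rewrite h2.
Qed.

Lemma KL_act0 mu nu (l : Lfiber x) : (forall p, bcat nu p <> Some (gc (val l))) ->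
  lact (leavitt_mono mu nu) (<< l >> : KL_left) = 0.
Proof. by move=> h; apply: br_act_mono0 => m /Lfiber_cat [/h]. Qed.

Definition Ind (N : leftModule (salg K (isotropy x))) : leftModule (leavitt K E) :=
  tensor_left KL N.
End Bimodule.
End Induction.

Record closed_path (E : digraph) := ClosedPath {
  cp_path :> fpath E;
  cp_pos : (0 < fp_len cp_path)%N;
  cp_closed : fp_rng cp_path = fp_src cp_path
}.

(* d^m is the m-fold concatenation of the edge sequence of d. *)
Definition simple_path (E : digraph) (c : closed_path E) : Prop :=
  forall (d : closed_path E) (m : nat), (2 <= m)%N ->
    fp_edges c <> flatten (nseq m (fp_edges d)).

Section CInfinity.
Context {E : digraph} (c : closed_path E).

Definition cinf_edge (i : nat) : edge E :=
  tnth (in_tuple (fp_edges c)) (Ordinal (ltn_pmod i (cp_pos c))).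

Lemma cinf_edgeE e0 i : cinf_edge i = nth e0 (fp_edges c) (i %% fp_len c)%N.
Proof. by rewrite /cinf_edge (tnth_nth e0). Qed.

Lemma is_path_nth (v : vertex E) l e0 i : is_path v l -> (i.+1 < size l)%N ->
  rng (nth e0 l i) = src (nth e0 l i.+1).
Proof.
elim: l v i => [|e l IH] v i //= /andP [_ hl]; case: i => [|i] hi.
  by case: l hl hi {IH} => [|f l] //= /andP [/eqP ->].
exact: IH hl hi.
Qed.

Lemma is_path_take (v : vertex E) l k : is_path v l -> is_path v (take k l).
Proof. by elim: l v k => [|e l IH] v [|k] //= /andP [-> /IH]; apply. Qed.

Fact cinf_path i : rng (cinf_edge i) = src (cinf_edge i.+1).
Proof.
have e0 : edge E by exact: (cinf_edge 0).
rewrite !(cinf_edgeE e0); have n0 := cp_pos c; set n := fp_len c in n0 *.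
have hi : (i %% n < n)%N by rewrite ltn_mod.
rewrite -addn1 -modnDml addn1.
have [lt|ge] := ltnP (i %% n).+1 n.
  by rewrite (modn_small lt); apply: is_path_nth lt; exact: fp_path.
have -> : (i %% n).+1 = n by apply/eqP; rewrite eqn_leq hi.
have -> : (i %% n = n.-1)%N by apply/eqP; rewrite eqn_leq -ltnS prednK // hi -ltnS prednK.
rewrite modnn nth_last; have := cp_closed c; have := fp_path c.
rewrite /n /fp_len /fp_rng in n0 *; case: (fp_edges c) n0 => [|e l] //= _.
by move=> /andP [/eqP -> _]; rewrite (last_map (@rng E)).
Qed.

Definition cinf : bpath E := BInf (IPath cinf_path).

Definition bnth (x : bpath E) (i : nat) : option (edge E) :=
  match x with BFin mu _ => onth (fp_edges mu) i | BInf f => Some (f i) end.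

Lemma bnth_bcons e (p : bpath E) (h : rng e = bsrc p) i :
  bnth (bcons h) i.+1 = bnth p i.
Proof. by case: p h. Qed.

Lemma bnth_seq l (p x : bpath E) i : bpre_seq l p = Some x ->
  bnth x (size l + i)%N = bnth p i.
Proof.
elim: l x => [|e l IH] x /=; first by case=> ->.
by case: bpre_seq IH => // y /(_ y erefl) <- /= /bpreP [h ->]; rewrite bnth_bcons.
Qed.

Lemma cinf_edgeD i k : cinf_edge (i + k * fp_len c)%N = cinf_edge i.
Proof.
have e0 : edge E by exact: (cinf_edge 0).
by rewrite !(cinf_edgeE e0) addnC modnMDl.
Qed.

Lemma period_dvdn (d : nat) : simple_path c ->
  (forall i, cinf_edge (i + d)%N = cinf_edge i) -> (fp_len c %| d)%N.
Proof.
move=> cs hd; have e0 : edge E by exact: (cinf_edge 0).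
have n0 := cp_pos c; pose g := gcdn (fp_len c) d.
have hdk i k : cinf_edge (i + k * d)%N = cinf_edge i.
  by elim: k => [|k IH]; rewrite ?addn0 // mulSn addnCA addnC hd.
have hg i : cinf_edge (i + g)%N = cinf_edge i.
  rewrite /g; case: (egcdnP d n0) => km kn eg _.
  by rewrite -[RHS](cinf_edgeD i km) eg -[LHS](hdk _ kn) -addnA (addnC (gcdn _ _)).
have g0 : (0 < g)%N by rewrite gcdn_gt0 n0.
have hgk i k : cinf_edge (i + k * g)%N = cinf_edge i.
  by elim: k => [|k IH]; rewrite ?addn0 // mulSn addnCA addnC hg.
have [q hq] : exists q, fp_len c = (q * g)%N.
  by exists (fp_len c %/ g)%N; rewrite divnK // dvdn_gcdl.
have [q2|q1] := leqP 2 q; last first.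
  have : q = 1%N.
    by case: q hq q1 => [|[|]] // h _; move: n0; rewrite h.
  by move=> q1'; rewrite hq q1' mul1n dvdn_gcdr.
have gn : (g < fp_len c)%N by rewrite hq ltn_Pmull.
pose t := take g (fp_edges c).
have st : size t = g by rewrite size_take -/(fp_len c) gn.
have tp : is_path (fp_src c) t by apply/is_path_take/fp_path.
have nt i : (i < g)%N -> nth e0 t i = cinf_edge i.
  move=> ig; rewrite nth_take // (cinf_edgeE e0) modn_small //.
  exact: ltn_trans gn.
clearbody t.
have tc : fp_rng (FPath tp) = fp_src (FPath tp).
  rewrite /fp_rng /=; have := tp; case et : t => [|e s].
    by move: st; rewrite et => st; rewrite -st in g0.
  move=> /= /andP [/eqP <- _].
  rewrite (last_map (@rng E)).
  have -> : last e s = nth e0 t g.-1 by rewrite -st et nth_last.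
  rewrite nt ?prednK // cinf_path prednK // -[g]add0n hg.
  by rewrite -nt // et.
have tpos : (0 < fp_len (FPath tp))%N by rewrite /fp_len /= st.
case: (cs (ClosedPath tpos tc) q q2) => /=.
apply: (@eq_from_nth _ e0) => [|i hi].
  by rewrite size_flatten /shape map_nseq sumn_nseq st mulnC -/(fp_len c) hq.
have -> : nth e0 (fp_edges c) i = cinf_edge i by rewrite (cinf_edgeE e0) modn_small.
have nf m j : (j < m * g)%N -> nth e0 (flatten (nseq m t)) j = cinf_edge j.
  elim: m j => [|m IH] j //=; rewrite mulSn nth_cat st => hj.
  case: ltnP => jg; first exact: nt.
  rewrite IH; last by rewrite ltn_subLR.
  by rewrite -[in RHS](subnK jg) hg.
by rewrite nf // -hq.
Qed.

Lemma isotropy_dvd (g : isotropy cinf) : simple_path c ->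
  (fp_len c %| `|gk (val g)|%N)%N.
Proof.
move=> cs; have := gP (val g); rewrite iso_c iso_d => /tail_eqP [l [m [p [hl hm ->]]]].
have main (s t : seq (edge E)) : (size s <= size t)%N ->
    bpre_seq s p = Some cinf -> bpre_seq t p = Some cinf ->
    (fp_len c %| size t - size s)%N.
  move=> st hs ht; apply: period_dvdn => // i.
  have h j : cinf_edge (size t + j)%N = cinf_edge (size s + j)%N.
    by have := bnth_seq j hs; rewrite -(bnth_seq j ht) => -[].
  have n0 := cp_pos c.
  have le : (size s <= i + size s * fp_len c)%N.
    by apply: leq_trans (leq_addl _ _); rewrite leq_pmulr.
  rewrite -[RHS](cinf_edgeD i (size s)) -[LHS](cinf_edgeD _ (size s)).
  rewrite -(subnKC le) -h; congr cinf_edge.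
  move: (size s * fp_len c)%N le => N le.
  by rewrite addnBA // -addnBA // [RHS]addnC addnBAC // addnAC addnBA // addnBAC.
have [st|st] := leqP (size m) (size l).
  by rewrite subzn // absz_nat; exact: main st hm hl.
by rewrite -abszN opprB subzn ?(ltnW st) // absz_nat; exact: main (ltnW st) hl hm.
Qed.
End CInfinity.

(* K'^(a): the element (c^infty, kn, c^infty) acts as a^k, with n = |c|; the
   division below is exact by isotropy_dvd. *)
Section IsotropyModule.
Context {K K' : fieldType} (iota : {rmorphism K -> K'}) {E : digraph}.
Context (c : closed_path E) (c_simple : simple_path c) (a : K').
Hypothesis a_neq0 : a != 0.

Definition iso_scalar (g : isotropy (cinf c)) : K' :=
  a ^ (gk (val g) %/ (fp_len c)%:Z)%Z.

Definition iso_act (b : salg K (isotropy (cinf c))) (m : restr iota K'^o) : restr iota K'^o :=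
  slext (fun g => iso_scalar g * m : restr iota K'^o) b.

Lemma iso_scalarM g h : iso_scalar (g * h)%g = iso_scalar g * iso_scalar h.
Proof.
rewrite /iso_scalar -expfzDr //; congr (a ^ _) => /=.
by rewrite divzDl // dvdzE isotropy_dvd.
Qed.

Lemma iso_scalarE g (k : int) : gk (val g) = k * (fp_len c)%:Z -> iso_scalar g = a ^ k.
Proof.
move=> e; rewrite /iso_scalar e mulzK //.
by have := cp_pos c; case: fp_len.
Qed.

Lemma iso_actU g m : iso_act (sbasis g) m = iso_scalar g * m.
Proof. exact: slextU. Qed.

Fact iso_act_linearl m : linear (fun b => iso_act b m).
Proof. exact: slextP. Qed.

Fact iso_act_linearr b : linear (iso_act b).
Proof.
move=> k m n; elim/(@salg_ind K (isotropy (cinf c))): b => [|l b b' IHb IHb'|g].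
- by rewrite /iso_act !linear0 ?scaler0 addr0.
- by rewrite !iso_act_linearl IHb IHb' !scalerDr !scalerA (mulrC l k) addrACA.
- by rewrite /iso_act !slextU !restrZ /= mulrDr /GRing.scale /= mulrCA.
Qed.

Fact iso_actM b b' m : iso_act (b ** b') m = iso_act b (iso_act b' m).
Proof.
have a0 m' : iso_act 0 m' = 0 by rewrite /iso_act linear0.
have ar0 d : iso_act d 0 = 0.
  exact: linear_zero (iso_act_linearr d).
elim/(@salg_ind K (isotropy (cinf c))): b => [|l b d IHb IHd|g].
- by rewrite nmul0r !a0.
- by rewrite nmulPl !iso_act_linearl IHb IHd.
elim/(@salg_ind K (isotropy (cinf c))): b' => [|l b d IHb IHd|h].
- by rewrite nmulr0 !a0 ar0.
- by rewrite nmulPr !iso_act_linearl IHb IHd -iso_act_linearr.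
by rewrite (iso_actU g) (iso_actU h) mulrA -iso_scalarM -iso_actU -sbasisM.
Qed.

Definition iso_module : leftModule (salg K (isotropy (cinf c))) :=
  LeftModule iso_act_linearl iso_act_linearr iso_actM.

Lemma iso_module_act g (m : K') : lact (sbasis g) (m : iso_module) = iso_scalar g * m.
Proof. exact: iso_actU. Qed.
End IsotropyModule.

Definition path_scalar (E : digraph) (K : fieldType) (a : edge E -> K) (mu : fpath E) : K :=
  \prod_(e <- fp_edges mu) a e.

Lemma path_scalar_neq0 (E : digraph) (K : fieldType) (a : edge E -> K) (mu : fpath E) :
  (forall e, a e != 0) -> path_scalar a mu != 0.
Proof. by move=> a0; rewrite /path_scalar prodf_seq_neq0; apply/allP => e _; apply/implyP. Qed.

(* Main.v *)
(* Comparing two factorizations x = mu p, y = nu p of an arrow (x, k, y) with the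
   same k shows that the ratio a_mu / a_nu does not depend on the factorization:
   it is a cocycle w on the graph groupoid, and on the isotropy group at c^infty
   it is the character kn |-> a_c^k.  Hence (y, k, c^infty) (x) b |-> b w(y, k, c^infty) y
   is balanced; it is equivariant because prepending an edge e multiplies w by
   a_e, and it is inverted by b y |-> l_y (x) b / w(l_y), where l_y is any element
   of L_{c^infty} over y. *)
Require Import Defs.
From HB Require Import structures.
From mathcomp Require Import all_boot all_order all_algebra.
From mathcomp Require Import finmap monalg ring.
From mathcomp Require Import boolp.

Set Implicit Arguments.
Unset Strict Implicit.
Unset Printing Implicit Defensive.

Import GRing.Theory.
Local Open Scope ring_scope.

(** * The weight cocycle on the graph groupoid *)

Section Weight.
Context {E : digraph} {F : fieldType} (a : edge E -> F).
Hypothesis a_neq0 : forall e, a e != 0.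

(** Taken on bare edge lists because [bpre_seq] consumes lists; on [fp_edges mu] it unfolds to
    [path_scalar a mu]. *)
Definition edges_scalar (l : seq (edge E)) : F := \prod_(e <- l) a e.

Lemma edges_scalar_neq0 l : edges_scalar l != 0.
Proof. by rewrite /edges_scalar prodf_seq_neq0; apply/allP => e _; apply/implyP. Qed.

Lemma edges_scalar_cat l m : edges_scalar (l ++ m) = edges_scalar l * edges_scalar m.
Proof. exact: big_cat. Qed.

Lemma edges_scalar_flatten_nseq k l :
  edges_scalar (flatten (nseq k l)) = edges_scalar l ^+ k.
Proof.
elim: k => [|k IH] /=; first exact: big_nil.
by rewrite edges_scalar_cat IH exprS.
Qed.

Lemma edges_scalar_ratio_cat l m b :
  edges_scalar (l ++ b) / edges_scalar (m ++ b) = edges_scalar l / edges_scalar m.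
Proof. by rewrite !edges_scalar_cat -mulf_div divff ?mulr1 ?edges_scalar_neq0. Qed.

Lemma bpre_seq_inj (l m : seq (edge E)) p q x : size l = size m ->
  bpre_seq l p = Some x -> bpre_seq m q = Some x -> l = m.
Proof.
move=> sz hl hm; have [b eb _] := bpre_seq_split (eq_leq sz) hl hm.
have : size m = (size l + size b)%N by rewrite eb size_cat.
rewrite -sz -[LHS]addn0 => /addnI/esym/size0nil b0.
by rewrite eb b0 cats0.
Qed.

(** If [l] is the shorter, then [l' = l ++ b], and equality of degrees gives [m' = m ++ b'] with [b]
    and [b'] of equal length. Both carry [p'] to [p], so they agree, and the common tail cancels
    from the ratio. *)
Lemma edges_scalar_ratio_uniq x y l m p l' m' p' :
  bpre_seq l p = Some x -> bpre_seq m p = Some y ->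
  bpre_seq l' p' = Some x -> bpre_seq m' p' = Some y ->
  (size l)%:Z - (size m)%:Z = (size l')%:Z - (size m')%:Z ->
  edges_scalar l / edges_scalar m = edges_scalar l' / edges_scalar m'.
Proof.
wlog le : l m p l' m' p' / (size l <= size l')%N => [th|].
  have [le|/ltnW le] := leqP (size l) (size l'); first exact: th.
  by move=> hx hy hx' hy' hk; apply/esym; apply: (th _ _ p' _ _ p).
move=> hx hy hx' hy' /eqP.
(* Clearing the subtractions turns the degree equation into [size l' + size m = size l + size m'] in
   nat. *)
rewrite subr_eq addrAC eq_sym subr_eq -!PoszD eqz_nat => /eqP sz.
have le' : (size m <= size m')%N.
  by rewrite -(leq_add2l (size l)) -sz leq_add2r.
have [b eb hb] := bpre_seq_split le hx hx'.
have [b' eb' hb'] := bpre_seq_split le' hy hy'.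
have ebb : b = b'.
  apply: bpre_seq_inj hb hb'; apply/eqP.
  by rewrite -(eqn_add2l (size l + size m)) -addnAC -size_cat -eb sz eb' size_cat addnA.
by rewrite eb eb' -ebb edges_scalar_ratio_cat.
Qed.

(** A factorization of an arrow exists only as a proposition, so the weight is picked by choice;
    [gweightE] shows that the pick is immaterial. *)
Fact gweight_subproof (g : gpd E) : exists w : F, exists l m p,
  [/\ bpre_seq l p = Some (gc g), bpre_seq m p = Some (gd g),
      gk g = (size l)%:Z - (size m)%:Z & w = edges_scalar l / edges_scalar m].
Proof.
have [l [m [p [hl hm hk]]]] := (tail_eqP _ _ _).1 (gP g).
by exists (edges_scalar l / edges_scalar m), l, m, p.
Qed.

Definition gweight (g : gpd E) : F := projT1 (cid (gweight_subproof g)).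

Lemma gweightE g l m p : bpre_seq l p = Some (gc g) -> bpre_seq m p = Some (gd g) ->
  gk g = (size l)%:Z - (size m)%:Z -> gweight g = edges_scalar l / edges_scalar m.
Proof.
rewrite /gweight; case: cid => w /= [l' [m' [p' [hl' hm' hk' ->]]]] hl hm hk.
apply: edges_scalar_ratio_uniq hl' hm' hl hm _.
by rewrite -hk' hk.
Qed.

Lemma gweightP g : exists l m p,
  [/\ bpre_seq l p = Some (gc g), bpre_seq m p = Some (gd g),
      gk g = (size l)%:Z - (size m)%:Z & gweight g = edges_scalar l / edges_scalar m].
Proof. exact: projT2 (cid (gweight_subproof g)). Qed.

Lemma gweight_neq0 g : gweight g != 0.
Proof.
have [l [m [p [_ _ _ ->]]]] := gweightP g.
by rewrite mulf_neq0 ?invr_neq0 ?edges_scalar_neq0.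
Qed.

(** One of the two factorizations of the middle path refines the other. If [t' = t ++ b], then
    [s ++ b] and [s'] factor the product over [q], and the weight of [t'] cancels; the other case is
    symmetric. *)
Lemma gweightM g h (e : gd g = gc h) : gweight (gmul e) = gweight g * gweight h.
Proof.
have [s [t [p [hs ht kg ->]]]] := gweightP g.
have [t' [s' [q [ht' hs' kh ->]]]] := gweightP h.
rewrite -e in ht'; case: (leqP (size t) (size t')) => sz.
  have [b eb hb] := bpre_seq_split sz ht ht'.
  rewrite (@gweightE _ (s ++ b) s' q) //=.
  - by rewrite -(edges_scalar_ratio_cat s t b) -eb mulrA divfK ?edges_scalar_neq0.
  - by rewrite bpre_seq_cat hb.
  by rewrite kg kh eb !size_cat !PoszD; ring.
have [b eb hb] := bpre_seq_split (ltnW sz) ht' ht.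
rewrite (@gweightE _ s (s' ++ b) p) //=.
- by rewrite -(edges_scalar_ratio_cat t' s' b) -eb mulrA divfK ?edges_scalar_neq0.
- by rewrite bpre_seq_cat hb.
by rewrite kg kh eb !size_cat !PoszD; ring.
Qed.

Lemma gweight_bpre e (g h : gpd E) : bpre e (gc g) = Some (gc h) -> gd h = gd g ->
  gk h = gk g + 1 -> gweight h = a e * gweight g.
Proof.
move=> hc hd hk; have [l [m [p [hl hm kg ->]]]] := gweightP g.
rewrite (@gweightE _ (e :: l) m p) /= ?hl ?hd //.
  by rewrite mulrA /edges_scalar big_cons.
by rewrite hk kg -addn1 PoszD addrAC.
Qed.
End Weight.

(** * The weight on the isotropy group at c^infty *)

Lemma bpre_seq_mkseq (E : digraph) n (f g : ipath E) : (forall i, g i = f (n + i)%N) ->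
  bpre_seq (mkseq f n) (BInf g) = Some (BInf f).
Proof.
elim: n f => [|n IH] f fg.
  by congr (Some (BInf _)); apply: ipath_eq.
pose f' := @IPath E (fun i => f i.+1) (fun i => ip_path f i.+1).
have -> : mkseq f n.+1 = f 0%N :: mkseq f' n.
  by rewrite /mkseq /= (iotaDl 1 0) -map_comp.
rewrite /= (IH f') //= (@bpreE _ _ (BInf f') (ip_path f 0)) /=.
by congr (Some (BInf _)); apply: ipath_eq; case.
Qed.

Section Cycle.
Context {E : digraph} (c : closed_path E).

(** One copy of c is absorbed at a time: the first |c| edges of c^infty are those of c, and dropping
    them changes nothing by periodicity. *)
Lemma bpre_seq_cinf k : bpre_seq (flatten (nseq k (fp_edges c))) (cinf c) = Some (cinf c).
Proof.
elim: k => [|k IH] //=; rewrite bpre_seq_cat IH /=.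
have e0 : edge E by exact: (cinf_edge c 0).
have -> : fp_edges c = mkseq (cinf_edge c) (fp_len c).
  apply: (@eq_from_nth _ e0) => [|i hi]; first by rewrite size_mkseq.
  by rewrite nth_mkseq // (cinf_edgeE c e0) modn_small.
apply: (@bpre_seq_mkseq E _ (IPath (@cinf_path E c))) => i /=.
by rewrite addnC -[X in (_ + X)%N]mul1n cinf_edgeD.
Qed.

(** Simplicity makes the degree a multiple k|c|. For k >= 0 the arrow factors as c^k over the empty
    path, for k < 0 as the empty path over c^(-k), with p = c^infty in both cases. *)
Lemma gweight_isotropy (F : fieldType) (a : edge E -> F) (a_neq0 : forall e, a e != 0)
    (g : isotropy (cinf c)) : simple_path c ->
  gweight a (val g) = iso_scalar (path_scalar a c) g.
Proof.
move=> c_simple.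
have sz k : size (flatten (nseq k (fp_edges c))) = (k * fp_len c)%N.
  by rewrite size_flatten /shape map_nseq sumn_nseq mulnC.
have /dvdzP [k hk] : ((fp_len c)%:Z %| gk (val g))%Z by rewrite dvdzE isotropy_dvd.
rewrite (iso_scalarE _ hk); case: k hk => k hk.
  rewrite (@gweightE _ _ _ a_neq0 _ (flatten (nseq k (fp_edges c))) [::] (cinf c)).
  - by rewrite edges_scalar_flatten_nseq /edges_scalar big_nil divr1.
  - by rewrite bpre_seq_cinf iso_c.
  - by rewrite iso_d.
  - by rewrite hk sz subr0 PoszM.
(* [Negz k] stands for -(k + 1), hence the [k.+1] copies of c. *)
rewrite (@gweightE _ _ _ a_neq0 _ [::] (flatten (nseq k.+1 (fp_edges c))) (cinf c)).
- by rewrite edges_scalar_flatten_nseq /edges_scalar big_nil div1r NegzE.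
- by rewrite iso_c.
- by rewrite bpre_seq_cinf iso_d.
- by rewrite hk sz NegzE sub0r PoszM mulNr.
Qed.
End Cycle.

(** * The equivariant map from KL_x to the twisted Chen module *)

Lemma linear_combACA (K : fieldType) (M : lmodType K) (k l : K) (u u' v v' : M) :
  l *: (k *: u + u') + (k *: v + v') = k *: (l *: u + v) + (l *: u' + v').
Proof. by rewrite !scalerDr !scalerA (mulrC l) addrACA. Qed.

Section FiberMap.
Context {E : digraph} (x : bpath E).

Fact Lfiber_orbit_subproof (l : Lfiber x) : `[< exists k, tail_eq (gc (val l)) k x >].
Proof. by apply/asboolP; exists (gk (val l)); exact: Lfiber_tail. Qed.

(** The projection L_x -> [x] that forgets the degree; its fibres are exactly the orbits of the
    right isotropy action, by [Lfiber_orbit_mul] and [Lfiber_orbit_eq]. *)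
Definition Lfiber_orbit (l : Lfiber x) : orbit_of x :=
  exist (fun y => is_true `[< exists k, tail_eq y k x >]) _ (Lfiber_orbit_subproof l).

Lemma Lfiber_orbit_mul l g : Lfiber_orbit (Lfiber_mul l g) = Lfiber_orbit l.
Proof. exact: val_inj. Qed.

Lemma Lfiber_orbit_surj (y : orbit_of x) : exists l, Lfiber_orbit l = y.
Proof.
have [k hk] := asboolP _ (valP y).
by have [l [hl _]] := Lfiber_mk hk; exists l; apply: val_inj.
Qed.

(** The arbitrarily chosen arrow l_y over [y] on which the inverse map is built. *)
Definition orbit_lift (y : orbit_of x) : Lfiber x := projT1 (cid (Lfiber_orbit_surj y)).

Lemma orbit_liftK y : Lfiber_orbit (orbit_lift y) = y.
Proof. exact: projT2 (cid (Lfiber_orbit_surj y)). Qed.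

(** The witness is the arrow l^(-1) l', which runs from x to x. *)
Lemma Lfiber_orbit_eq (l l' : Lfiber x) : Lfiber_orbit l = Lfiber_orbit l' ->
  exists g : isotropy x, l' = Lfiber_mul l g.
Proof.
move=> /(congr1 val) /= hc.
have ht : tail_eq x (- gk (val l) + gk (val l')) x.
  apply: tail_eq_trans (tail_eq_sym (Lfiber_tail l)) _.
  by rewrite hc; exact: Lfiber_tail.
have hg : (gc (Gpd ht) == x) && (gd (Gpd ht) == x) by rewrite /= eqxx.
exists (exist (fun g => is_true ((gc g == x) && (gd g == x))) _ hg).
by apply: Lfiber_eq; rewrite //= addNKr.
Qed.

(** The projection intertwines the generators and also preserves where they are undefined, so a zero
    on one side is a zero on the other. *)
Lemma br_gen_Lfiber_orbit t (l : Lfiber x) :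
  br_gen (chen_branching x) t (Lfiber_orbit l) =
  omap Lfiber_orbit (br_gen (Lfiber_branching x) t l).
Proof.
have pre e (k m : Lfiber x) :
    Lfiber_pre e k = Some m -> orbit_pre e (Lfiber_orbit k) = Some (Lfiber_orbit m).
  by move=> /Lfiber_preP [h _]; exact: orbit_pre_val.
case: t => [v|e|e] /=; first by case: eqP.
  case h : Lfiber_pre => [m|] /=; first exact: pre.
  case h' : orbit_pre => [z|] //.
  by have := orbit_pre_dom e (Lfiber_orbit l); rewrite h' -(Lfiber_pre_dom e l) h.
case h : (pinv (Lfiber_pre e) l) => [m|] /=.
  exact: (@br_pinv E _ (chen_branching x) e _ _ (pre _ _ _ (pinvP h))).
apply: pinv_none => y /orbit_preP /= hy.
(* If the underlying path loses a first edge [e], the arrow [l] does too: the shortened path carries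
   an arrow of degree one less. *)
have [|m [hm hk]] := @Lfiber_mk E x (val y) (- 1 + gk (val l)).
  apply: tail_eq_trans (Lfiber_tail l); apply/tail_eqP; exists [::], [:: e], (val y).
  by split.
have hl : Lfiber_pre e m = Some l.
  by apply/Lfiber_preP; rewrite hm hk addrAC addNr add0r.
by have := @br_pinv E _ (Lfiber_branching x) e _ _ hl; rewrite /= h.
Qed.

Context {K K' : fieldType} (iota : {rmorphism K -> K'}).
Context (a : edge E -> K') (a_neq0 : forall e, a e != 0).

Lemma gweight_Lfiber_mul (l : Lfiber x) (g : isotropy x) :
  gweight a (val (Lfiber_mul l g)) = gweight a (val l) * gweight a (val g).
Proof. exact: (gweightM a_neq0 (Lfiber_comp l g)). Qed.

Local Notation V := (restr_module iota (twist_module a_neq0 (chen_module x K'))).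

(* The scalar is in K', but V is only a K-space. *)
Definition orbit_term (k : K') (y : orbit_of x) : V :=
  (k *: << y >> : {malg K'[orbit_of x]}).

Lemma orbit_termP k (b c : K') y :
  orbit_term (iota k * b + c) y = k *: orbit_term b y + orbit_term c y.
Proof. by rewrite /orbit_term scalerDl -scalerA. Qed.

Lemma orbit_term0 y : orbit_term 0 y = 0.
Proof. by rewrite /orbit_term scale0r. Qed.

(** The factor by which sigma_a scales a generator. By [gweight_br_gen] the same factor relates the
    weights before and after that generator acts, which gives equivariance. *)
Definition gen_scalar (t : lgen E) : K' :=
  match t with Lv _ => 1 | Le e => a e | Ls e => (a e)^-1 end.

Lemma lact_orbit_term t b y :
  lact (leavitt_gen K t) (orbit_term b y) =
  if br_gen (chen_branching x) t y is Some z then orbit_term (gen_scalar t * b) z else 0.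
Proof.
have lZ u k (m : {malg K'[orbit_of x]}) :
    br_act (chen_branching x) u (k *: m) = k *: br_act (chen_branching x) u m.
  by rewrite /br_act linearZ.
have Zl u k (m : {malg K'[orbit_of x]}) :
    br_act (chen_branching x) (k *: u) m = k *: br_act (chen_branching x) u m.
  by rewrite /br_act linearZ.
(* By conversion, the action on [V] is the untwisted one of [sigma] applied to the base change. *)
rewrite -[LHS]/(br_act (chen_branching x)
  (sigma a_neq0 (base_change iota (leavitt_gen K t))) (b *: << y >>)).
have -> : base_change iota (leavitt_gen K t) = leavitt_gen K' t.
  exact: leavitt_lift_gen.
have -> : sigma a_neq0 (leavitt_gen K' t) = sigma_gen a t by exact: leavitt_lift_gen.
rewrite lZ; have -> : br_act (chen_branching x) (sigma_gen a t) << y >> =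
    gen_scalar t *: br_act (chen_branching x) (leavitt_gen K' t) << y >>.
  by case: t => [v|e|e] /=; rewrite ?scale1r ?Zl.
rewrite br_act_gen scalerA mulrC /orbit_term.
by case: br_gen => [z|] //=; rewrite scaler0.
Qed.

Lemma gweight_br_gen t (l m : Lfiber x) : br_gen (Lfiber_branching x) t l = Some m ->
  gweight a (val m) = gen_scalar t * gweight a (val l).
Proof.
have pre e (k n : Lfiber x) :
    Lfiber_pre e k = Some n -> gweight a (val n) = a e * gweight a (val k).
  move=> /Lfiber_preP [hc hk]; apply: (gweight_bpre a_neq0) => //.
  by rewrite (eqP (valP k)) (eqP (valP n)).
case: t => [v|e|e] /=; first by case: eqP => // _ [->]; rewrite mul1r.
  exact: pre.
by move=> h; rewrite (pre _ _ _ (pinvP h)) mulKf.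
Qed.

(** The balanced pairing with the K'-factor [b] as a parameter: K-linearity in the KL_x argument
    comes from [lext], and K-linearity in [b] is proved separately. *)
Definition twisted_map (b : K') : KL_left x K -> V :=
  lext (fun l => orbit_term (b * gweight a (val l)) (Lfiber_orbit l)).

Lemma twisted_mapU b l :
  twisted_map b << l >> = orbit_term (b * gweight a (val l)) (Lfiber_orbit l).
Proof. exact: lextU. Qed.

Lemma twisted_map_linearr b k m n :
  twisted_map b (k *: m + n) = k *: twisted_map b m + twisted_map b n.
Proof. exact: linearP. Qed.

Lemma twisted_map0 b : twisted_map b 0 = 0.
Proof. exact: linear_zero (twisted_map_linearr b). Qed.

Lemma twisted_map_linearl m k (b c : K') :
  twisted_map (iota k * b + c) m = k *: twisted_map b m + twisted_map c m.
Proof.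
elim/(@malg_ind K (Lfiber x)): m => [|l m n IHm IHn|l].
- by rewrite !twisted_map0 scaler0 addr0.
- by rewrite !twisted_map_linearr IHm IHn; exact: linear_combACA.
by rewrite !twisted_mapU -orbit_termP mulrDl mulrA.
Qed.

(** Equivariance passes to combinations and products, so a generator acting on a basis arrow
    suffices; there the twist on one side equals the change of weight on the other. *)
Lemma twisted_map_act u b m : twisted_map b (lact u m) = lact u (twisted_map b m).
Proof.
elim/(@leavitt_ind K E): u m => [|k u v IHu IHv|u v IHu IHv|t] m.
- by rewrite !(linear_zero (lact_linearl _)) twisted_map0.
- by rewrite !lact_linearl twisted_map_linearr IHu IHv.
- by rewrite !lactM IHu IHv.
elim/(@malg_ind K (Lfiber x)): m => [|k m n IHm IHn|l].
- by rewrite !(twisted_map0, linear_zero (lact_linearr _)).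
- by rewrite !(lact_linearr, twisted_map_linearr) IHm IHn.
rewrite twisted_mapU lact_orbit_term br_gen_Lfiber_orbit.
have -> : lact (leavitt_gen K t) (<< l >> : KL_left x K) =
  obasis (br_gen (Lfiber_branching x) t l) by exact: br_act_gen.
case h : br_gen => [m|] /=; last exact: twisted_map0.
by rewrite twisted_mapU (gweight_br_gen h) mulrCA.
Qed.
End FiberMap.

(** * K-linear maps out of a K'-space with a basis *)

Section SemilinearExtension.
Context {K K' : fieldType} (iota : {rmorphism K -> K'}) {X : choiceType} {W : lmodType K}.
Variable h : X -> K' -> W.
Hypothesis hP : forall y k b c, h y (iota k * b + c) = k *: h y b + h y c.

(** The source has a basis over K' while [W] is only a K-space, so [lext] does not apply: each basis
    vector y contributes a K-linear map [h y] on its whole line K' y. *)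
Definition slext_malg (u : {malg K'[X]}) : W := \sum_(y <- msupp u) h y u@_y.

Let h0 y : h y 0 = 0.
Proof. by have := hP y (-1) 0 0; rewrite mulr0 addr0 scaleN1r addNr. Qed.

Lemma slext_malgEw u (D : {fset X}) :
  (msupp u `<=` D)%fset -> slext_malg u = \sum_(y <- D) h y u@_y.
Proof.
rewrite /slext_malg => sD; apply: big_fset_incl => // y _.
by move=> /mcoeff_outdom ->.
Qed.

Lemma slext_malgP k u v : slext_malg (iota k *: u + v) = k *: slext_malg u + slext_malg v.
Proof.
pose D := (msupp u `|` (msupp v `|` msupp (iota k *: u + v)))%fset.
rewrite !(@slext_malgEw _ D) /D ?fsubsetUl //.
- rewrite scaler_sumr -big_split /=; apply: eq_bigr => y _.
  by rewrite mcoeffD mcoeffZ hP.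
- by rewrite fsubsetU // fsubsetUl orbT.
by rewrite fsubsetU // fsubsetUr orbT.
Qed.

Lemma slext_malgU b y : slext_malg (b *: << y >>) = h y b.
Proof.
rewrite (@slext_malgEw _ [fset y]%fset) ?big_seq_fset1.
  by rewrite mcoeffZ mcoeffUU mulr1.
apply/fsubsetP => z; rewrite -mcoeff_neq0 mcoeffZ mcoeffU inE (eq_sym y).
by case: (eqVneq z y) => //; rewrite mulr0n mulr0 eqxx.
Qed.
End SemilinearExtension.

(** * Universal property of the balanced tensor product *)

Section TensorLift.
Context {K : fieldType} {B : nualgType K} {M : rightModule B} {N : leftModule B}.
Context {W : lmodType K} (f : M -> N -> W).
Hypothesis f_linearl : forall n, linear (f^~ n).
Hypothesis f_linearr : forall m, linear (f m).
Hypothesis f_balanced : forall m b n, f (ract m b) n = f m (lact b n).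

Let pre (u : {malg K[(M * N)%type]}) : W := lext (fun mn => f mn.1 mn.2) u.

Let preU m n : pre << (m, n) >> = f m n.
Proof. exact: lextU. Qed.

Fact tensor_lift_subproof u : @tensor_relators K B M N u -> pre u = 0.
Proof.
have pB w v : pre (w - v) = pre w - pre v by exact: linearB.
have pD w v : pre (w + v) = pre w + pre v by exact: linearD.
have pZ k w : pre (k *: w) = k *: pre w by exact: linearZ.
have eq_subr0 (y z : W) : y = z -> y - z = 0 by move=> ->; rewrite subrr.
have fDl n m m' : f (m + m') n = f m n + f m' n.
  by have := f_linearl n 1 m m'; rewrite /= !scale1r.
have fDr m n n' : f m (n + n') = f m n + f m n'.
  by have := f_linearr m 1 n n'; rewrite !scale1r.
have fZl n k m : f (k *: m) n = k *: f m n.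
  by have := f_linearl n k m 0; rewrite /= (linear_zero (f_linearl n)) !addr0.
have fZr m k n : f m (k *: n) = k *: f m n.
  by have := f_linearr m k n 0; rewrite (linear_zero (f_linearr m)) !addr0.
case=> [[[m [m' [n ->]]]|[m [n [n' ->]]]|[k [m [n ->]]]|[k [m [n ->]]]]|[m [b [n ->]]]];
  rewrite pB; apply: eq_subr0.
- by rewrite pD !preU.
- by rewrite pD !preU.
- by rewrite pZ !preU.
- by rewrite pZ !preU.
by rewrite !preU.
Qed.

Definition tensor_lift : {linear tensor M N -> W} :=
  lquot_lift (f := lext (fun mn : M * N => f mn.1 mn.2)) tensor_lift_subproof.

Lemma tensor_liftE m n : tensor_lift (tens m n) = f m n.
Proof. by rewrite /tensor_lift /= lquot_liftE; exact: preU. Qed.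
End TensorLift.

Lemma tensPr (K : fieldType) (B : nualgType K) (M : rightModule B) (N : leftModule B)
  k (m : M) (n n' : N) : tens m (k *: n + n') = k *: tens m n + tens m n'.
Proof.
rewrite /tens -linearP /=.
transitivity (lpi (@tensor_relators K B M N) (<<(m, k *: n)>> + <<(m, n')>>)).
  by apply: lpi_gen; left; apply: Or42; exists m, (k *: n), n'.
rewrite !lpiD; congr (_ + _).
by apply: lpi_gen; left; apply: Or44; exists k, m, n.
Qed.

Lemma tens_balanced (K : fieldType) (B : nualgType K) (M : rightModule B) (N : leftModule B)
  (m : M) b (n : N) : tens (ract m b) n = tens m (lact b n).
Proof. by apply: lpi_gen; right; exists m, b, n. Qed.

(** * The isomorphism and its inverse *)

Section Iso.
Context {E : digraph} {K K' : fieldType} (iota : {rmorphism K -> K'}).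
Context (c : closed_path E) (c_simple : simple_path c).
Context (a : edge E -> K') (a_neq0 : forall e, a e != 0).

Local Notation V := (restr_module iota (twist_module a_neq0 (chen_module (cinf c) K'))).
Local Notation N := (iso_module iota c_simple (path_scalar_neq0 c a_neq0)).
Local Notation KLr := (bm_right (KL (cinf c) K)).
Local Notation KLl := (KL_left (cinf c) K).

(** On basis elements this is w(l g) = w(l) w(g), together with the fact that [g] acts on K'^(a) by
    w(g). *)
Lemma twisted_map_balanced (m : KLl) u (b : N) :
  twisted_map iota a_neq0 b (KL_ract m u) = twisted_map iota a_neq0 (lact u b) m.
Proof.
elim/(@malg_ind K (Lfiber (cinf c))): m => [|k m n IHm IHn|l].
- by rewrite KL_ract0l !twisted_map0.
- by rewrite KL_ractPl !twisted_map_linearr IHm IHn.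
elim/(@salg_ind K (isotropy (cinf c))): u => [|k u v IHu IHv|g].
- rewrite KL_ract0r twisted_map0 (linear_zero (lact_linearl b)).
  by rewrite twisted_mapU mul0r orbit_term0.
- rewrite KL_ractPr twisted_map_linearr IHu IHv lact_linearl.
  exact/esym/(twisted_map_linearl iota a_neq0 _ k (lact u b) (lact v b)).
rewrite KL_ractU iso_module_act !twisted_mapU Lfiber_orbit_mul.
rewrite (gweight_Lfiber_mul a_neq0 l g) (gweight_isotropy a_neq0 g c_simple).
by rewrite (mulrC (gweight _ _)) mulrA (mulrC b).
Qed.

Definition ind_map : {linear tensor KLr N -> V} :=
  @tensor_lift K _ KLr N V (fun m b => twisted_map iota a_neq0 b m)
    (fun b => twisted_map_linearr iota a_neq0 b)
    (fun m k => twisted_map_linearl iota a_neq0 m k)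
    twisted_map_balanced.

Lemma ind_mapE (m : KLr) (b : N) : ind_map (tens m b) = twisted_map iota a_neq0 b m.
Proof. exact: tensor_liftE. Qed.

Lemma ind_map_lact u (t : Ind N) : ind_map (lact u t) = lact u (ind_map t).
Proof.
elim/(@tensor_ind K _ KLr N): t => [|k s t IHs IHt|m b].
- by rewrite !(linear_zero (lact_linearr _), linear0).
- by rewrite lact_linearr !linearP IHs IHt lact_linearr.
have -> : lact u (tens m b : Ind N) = tens (lact u (m : KLl) : KLr) b.
  exact: tensor_lactE.
apply: etrans (ind_mapE (lact u (m : KLl)) b) _; rewrite ind_mapE.
exact: twisted_map_act.
Qed.

Definition ind_term (y : orbit_of (cinf c)) (b : K') : tensor KLr N :=
  @tens K _ KLr N << orbit_lift y >> (b / gweight a (val (orbit_lift y)) : K').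

Lemma ind_termP y k b d : ind_term y (iota k * b + d) = k *: ind_term y b + ind_term y d.
Proof.
rewrite /ind_term mulrDl -mulrA.
exact: (@tensPr K _ KLr N).
Qed.

Definition ind_inv (v : V) : tensor KLr N := slext_malg ind_term v.

Lemma ind_invP k (u v : V) : ind_inv (k *: u + v) = k *: ind_inv u + ind_inv v.
Proof. exact: (slext_malgP ind_termP). Qed.

Lemma ind_inv_term b y : ind_inv (orbit_term iota a_neq0 b y) = ind_term y b.
Proof. exact: (slext_malgU ind_termP). Qed.

(** Independence of the choice of l_y: write l = l_y g and move [g] across the tensor sign, where it
    becomes the scalar w(g) = w(l) / w(l_y). *)
Lemma ind_term_fiber (l : Lfiber (cinf c)) b :
  ind_term (Lfiber_orbit l) (b * gweight a (val l)) = @tens K _ KLr N << l >> (b : K').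
Proof.
have [g hg] := Lfiber_orbit_eq (orbit_liftK (Lfiber_orbit l)).
rewrite [in RHS]hg -KL_ractU.
have -> : @tens K _ KLr N (KL_ract << orbit_lift (Lfiber_orbit l) >> (sbasis g)) (b : K') =
  @tens K _ KLr N << orbit_lift (Lfiber_orbit l) >> (lact (sbasis g) (b : N)).
  exact: (@tens_balanced K _ KLr N).
rewrite iso_module_act -(gweight_isotropy a_neq0 g c_simple) /ind_term.
congr (@tens K _ KLr N _ _).
have -> : gweight a (val l) = gweight a (val (orbit_lift (Lfiber_orbit l))) * gweight a (val g).
  by rewrite [in LHS]hg (gweight_Lfiber_mul a_neq0 _ g).
by rewrite mulrC mulrCA mulKf ?gweight_neq0 // mulrC.
Qed.

Lemma ind_mapK : cancel ind_map ind_inv.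
Proof.
have inv0 : ind_inv 0 = 0 by exact: linear_zero ind_invP.
elim/(@tensor_ind K _ KLr N) => [|k s t IHs IHt|m b].
- by rewrite linear0.
- by rewrite linearP ind_invP IHs IHt.
rewrite ind_mapE; elim/(@malg_ind K (Lfiber (cinf c))): m => [|k m n IHm IHn|l].
- rewrite twisted_map0 inv0.
  (* Linearity with scalar -1 at zero yields 0 (x) b = 0. *)
  have := @tensPl K _ KLr N (-1) 0 0 b.
  by rewrite scaler0 addr0 scaleN1r addNr.
- rewrite twisted_map_linearr ind_invP IHm IHn.
  exact/esym/(@tensPl K _ KLr N).
by rewrite twisted_mapU ind_inv_term ind_term_fiber.
Qed.

Lemma ind_map_term y b : ind_map (ind_term y b) = orbit_term iota a_neq0 b y.
Proof.
rewrite ind_mapE twisted_mapU orbit_liftK divfK //.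
exact: gweight_neq0.
Qed.

Lemma ind_invK : cancel ind_inv ind_map.
Proof.
move=> v; rewrite /ind_inv /slext_malg linear_sum.
(* The basis expansion of [v] has coefficients in K', so it is taken in the underlying K'-space
   rather than in [V]. *)
rewrite [RHS](monalgE (v : {malg K'[orbit_of (cinf c)]})).
apply: eq_bigr => y _; rewrite ind_map_term.
by apply/malgP => z; rewrite mcoeffZ !mcoeffU mulr_natr.
Qed.
End Iso.

Theorem proposition4p15 (E : digraph) (K K' : fieldType) (iota : {rmorphism K -> K'})
    (c : closed_path E) (c_simple : simple_path c)
    (a : edge E -> K') (a_neq0 : forall e : edge E, a e != 0) :
  module_iso
    (Ind (iso_module iota c_simple (path_scalar_neq0 c a_neq0)))
    (restr_module iota (twist_module a_neq0 (chen_module (cinf c) K'))).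
Proof.
exists (ind_map iota c_simple a_neq0); last exact: ind_map_lact.
by exists (@ind_inv _ _ _ iota _ c_simple _ a_neq0); [exact: ind_mapK | exact: ind_invK].
Qed.
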